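(* Let $\overline{M}$ be a smooth manifold with boundary $\partial M$ and interior $M$. Fix $\alpha\in(0,2]$ such that $\frac{2}{\alpha}$ is an integer. Suppose that $g$ is a pseudo-Riemannian metric on $M$ such that for each point $x_0\in\partial M$ there are an open neighborhood $U$ of $x_0$ in $\overline{M}$, a defining function $\rho:U\to\mathbb{R}_{\ge 0}$ for the boundary, and a nowhere vanishing smooth function $C:U\to\mathbb{R}$ such that: - for any vector field $\zeta\in\mathfrak{X}(U)$ with $d\rho(\zeta)=0$, the function $\rho^{-2/\alpha}\,\zeta\cdot C$ is smooth up to the boundary; - the tensor field $$h:=\rho^{2/\alpha}g-C\,\frac{d\rho\odot d\rho}{\rho^{2/\alpha}}$$ on $U\cap M$ extends smoothly to the boundary (i.e. to $U$), and the restriction of the extension to the boundary is non-degenerate as a bilinear form on the boundary tangent bundle $T(U\cap\partial M)$. Then $g$ is projectively compact of order $\alpha$.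
   Context: All affine connections are torsion free; smooth means $C^\infty$. For a one-form $\Upsilon$, write $\hat\nabla=\nabla+\Upsilon$ for the connection $\hat\nabla_\xi\eta=\nabla_\xi\eta+\Upsilon(\xi)\eta+\Upsilon(\eta)\xi$. A (local) defining function for $\partial M$ is a smooth function $\rho:U\to\mathbb{R}_{\ge 0}$ on an open subset $U\subset\overline{M}$ with $\rho^{-1}(\{0\})=U\cap\partial M$ and $d\rho$ nowhere vanishing on $U\cap\partial M$. An affine connection $\nabla$ on $M$ is projectively compact of order $\alpha>0$ if every $x\in\partial M$ has a neighborhood $U$ in $\overline{M}$ with a defining function $\rho:U\to\mathbb{R}$ such that the connection $\hat\nabla=\nabla+\frac{d\rho}{\alpha\rho}$ on $U\cap M$ extends smoothly to all of $U$ (for vector fields $\xi,\eta$ smooth up to the boundary, $\hat\nabla_\xi\eta$ is smooth up to the boundary). A pseudo-Riemannian metric on $M$ is projectively compact of order $\alpha$ if its Levi-Civita connection is. Here $d\rho\odot d\rho$ is the symmetric tensor $(\xi,\eta)\mapsto d\rho(\xi)d\rho(\eta)$, and $\zeta\cdot C$ is the derivative of $C$ along $\zeta$. *)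

(* Defs.v *)
From HB Require Import structures.
From mathcomp Require Import all_boot all_order all_algebra.
From mathcomp Require Import all_classical all_reals all_analysis.
Set Implicit Arguments.
Unset Strict Implicit.
Unset Printing Implicit Defensive.
Import Order.TTheory GRing.Theory Num.Theory.
Import numFieldNormedType.Exports.
Local Open Scope classical_set_scope.
Local Open Scope ring_scope.

Section Euclidean.
Context {R : realType} {n : nat}.
Implicit Types (f : 'rV[R]_n.+1 -> R) (V A : set 'rV[R]_n.+1).

(* [k]-fold Frechet differentiability: in finite dimension [df] is
   differentiable iff every directional derivative ['D_v f] is. *)
Fixpoint times_differentiable (k : nat) V f : Prop :=
  if k is k'.+1 then
    (forall x, V x -> differentiable f x) /\
    (forall v, times_differentiable k' V ('D_v f))
  else True.

Definition C_infty V f := forall k, times_differentiable k V f.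

(* Smoothness on a set that need not be open, in practice a relatively open
   subset of the half-space: local existence of smooth extensions. *)
Definition smooth_on A f :=
  forall x, A x -> exists (V : set 'rV[R]_n.+1) (F : 'rV[R]_n.+1 -> R),
    [/\ open V, V x, C_infty V F & forall y, A y -> V y -> F y = f y].

Definition half_space : set 'rV[R]_n.+1 := [set x | 0 <= x 0 ord0].

(* One-sided, so that it makes sense at the boundary points of the half-space;
   it is the usual partial derivative of any smooth extension of [f]. *)
Definition partial (k : 'I_n.+1) f (x : 'rV[R]_n.+1) : R :=
  lim ((fun t : R => t^-1 * (f (x + t *: delta_mx 0 k) - f x)) @ 0^'+).

End Euclidean.

(* Smooth structure of dimension [n.+1] on the manifold with boundary [T].
   [chart_at] witnesses that the charts cover [T]; it also serves to fix
   coordinates on each tangent space, see below. *)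
Record bmanifold (R : realType) (n : nat) (T : topologicalType) := BManifold {
  index : Type;
  dom : index -> set T;
  chart : index -> T -> 'rV[R]_n.+1;
  chart_inv : index -> 'rV[R]_n.+1 -> T;
  chart_at : T -> index;
  bm_hausdorff : hausdorff_space T;
  bm_second_countable : @second_countable T;
  dom_open : forall i, open (dom i);
  mem_chart_at : forall p, dom (chart_at p) p;
  chart_img_open : forall i, exists2 O : set 'rV[R]_n.+1,
    open O & chart i @` dom i = O `&` half_space;
  chartK : forall i p, dom i p -> chart_inv i (chart i p) = p;
  chart_continuous : forall i, {within dom i, continuous (chart i)};
  chart_inv_continuous :
    forall i, {within chart i @` dom i, continuous (chart_inv i)};
  chart_compatible : forall i j k,
    smooth_on (chart i @` (dom i `&` dom j))
      (fun x => chart j (chart_inv i x) 0 k)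
}.

Section Manifold.
Context {R : realType} {n : nat} {T : topologicalType} (M : bmanifold R n T).
Implicit Types (W : set T) (f : T -> R) (p : T).

Definition boundary : set T :=
  [set p | exists i : index M, dom i p /\ chart i p 0 ord0 = 0].
Definition interior_part : set T := ~` boundary.

Definition smooth_fun W f :=
  forall i : index M, smooth_on (chart i @` (W `&` dom i)) (f \o chart_inv i).

(* The tangent space at [p] is represented by ['rV_n.+1] through the
   coordinates of the chart [chart_at M p].  [jac i j p] is the Jacobian of the
   change of charts from [i] to [j], acting on row vectors on the right. *)
Definition jac (i j : index M) p : 'M[R]_n.+1 :=
  \matrix_(k, l)
    partial k (fun x => chart j (chart_inv i x) 0 l) (chart i p).

Definition vfield := T -> 'rV[R]_n.+1.

Definition vcomp (i : index M) (X : vfield) p : 'rV[R]_n.+1 :=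
  X p *m jac (chart_at M p) i p.

Definition smooth_vfield W (X : vfield) :=
  forall i k, smooth_fun (W `&` dom i) (fun p => vcomp i X p 0 k).

(* The differential of [f] at [p], applied to a tangent vector. *)
Definition diff_at f p (v : 'rV[R]_n.+1) : R :=
  \sum_k v 0 k *
    partial k (f \o chart_inv (chart_at M p)) (chart (chart_at M p) p).

Definition deriv_along (X : vfield) f : T -> R := fun p => diff_at f p (X p).

(* Tangent vectors to the boundary, at a boundary point. *)
Definition tangent_boundary : set 'rV[R]_n.+1 := [set v | v 0 ord0 = 0].

(* A (0,2)-tensor field, given by its Gram matrix at [p] in the chart
   [chart_at M p]. *)
Definition tensor2 := T -> 'M[R]_n.+1.

Definition bil (B : 'M[R]_n.+1) (v w : 'rV[R]_n.+1) : R :=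
  (v *m B *m w^T) 0 0.

Definition tcomp (i : index M) (g : tensor2) p : 'M[R]_n.+1 :=
  jac i (chart_at M p) p *m g p *m (jac i (chart_at M p) p)^T.

Definition smooth_tensor2 W (g : tensor2) :=
  forall i k l, smooth_fun (W `&` dom i) (fun p => tcomp i g p k l).

Definition nondegenerate_on (V : set 'rV[R]_n.+1) (B : 'M[R]_n.+1) :=
  forall v, V v -> (forall w, V w -> bil B v w = 0) -> v = 0.

(* The values of [g] on the boundary are irrelevant. *)
Definition pseudo_riemannian (g : tensor2) :=
  smooth_tensor2 interior_part g /\
  forall p, interior_part p ->
    (forall v w, bil (g p) v w = bil (g p) w v) /\
    nondegenerate_on setT (g p).

(* Torsion-free affine connections on the open set [S], as operators acting on
   the smooth vector fields of every open [W `<=` S], compatibly with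
   restriction ([conn_local]).  [conn_torsion_free] is the equation
   nabla_X Y - nabla_Y X = [X, Y], with the Lie bracket written as a
   derivation. *)
Record affine_connection (S : set T) (nabla : vfield -> vfield -> vfield) :
    Prop := AffineConnection {
  conn_local : forall W, open W -> W `<=` S -> forall X X' Y Y',
    smooth_vfield W X -> smooth_vfield W Y ->
    (forall p, W p -> X p = X' p) -> (forall p, W p -> Y p = Y' p) ->
    forall p, W p -> nabla X Y p = nabla X' Y' p;
  conn_smooth : forall W, open W -> W `<=` S -> forall X Y,
    smooth_vfield W X -> smooth_vfield W Y -> smooth_vfield W (nabla X Y);
  conn_addl : forall W, open W -> W `<=` S -> forall X X' Y,
    smooth_vfield W X -> smooth_vfield W X' -> smooth_vfield W Y ->
    forall p, W p ->
      nabla (fun q => X q + X' q) Y p = nabla X Y p + nabla X' Y p;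
  conn_scalel : forall W, open W -> W `<=` S -> forall f X Y,
    smooth_fun W f -> smooth_vfield W X -> smooth_vfield W Y ->
    forall p, W p -> nabla (fun q => f q *: X q) Y p = f p *: nabla X Y p;
  conn_addr : forall W, open W -> W `<=` S -> forall X Y Y',
    smooth_vfield W X -> smooth_vfield W Y -> smooth_vfield W Y' ->
    forall p, W p ->
      nabla X (fun q => Y q + Y' q) p = nabla X Y p + nabla X Y' p;
  conn_leibniz : forall W, open W -> W `<=` S -> forall f X Y,
    smooth_fun W f -> smooth_vfield W X -> smooth_vfield W Y ->
    forall p, W p ->
      nabla X (fun q => f q *: Y q) p
        = deriv_along X f p *: Y p + f p *: nabla X Y p;
  conn_torsion_free : forall W, open W -> W `<=` S -> forall X Y f,
    smooth_vfield W X -> smooth_vfield W Y -> smooth_fun W f ->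
    forall p, W p ->
      diff_at f p (nabla X Y p - nabla Y X p)
        = deriv_along X (deriv_along Y f) p - deriv_along Y (deriv_along X f) p
}.

Definition levi_civita (g : tensor2) (nabla : vfield -> vfield -> vfield) :=
  affine_connection interior_part nabla /\
  forall W, open W -> W `<=` interior_part -> forall X Y Z,
    smooth_vfield W X -> smooth_vfield W Y -> smooth_vfield W Z ->
    forall p, W p ->
      deriv_along X (fun q => bil (g q) (Y q) (Z q)) p
        = bil (g p) (nabla X Y p) (Z p) + bil (g p) (Y p) (nabla X Z p).

Definition defining_function (U : set T) (rho : T -> R) :=
  [/\ smooth_fun U rho,
      forall p, U p -> 0 <= rho p,
      forall p, U p -> (rho p = 0 <-> boundary p) &
      forall p, U p -> boundary p -> exists v, diff_at rho p v != 0].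

Definition proj_change (nabla : vfield -> vfield -> vfield)
    (Upsilon : T -> 'rV[R]_n.+1 -> R) (X Y : vfield) : vfield :=
  fun p => nabla X Y p + Upsilon p (X p) *: Y p + Upsilon p (Y p) *: X p.

Definition projectively_compact_connection (alpha : R)
    (nabla : vfield -> vfield -> vfield) :=
  forall x, boundary x -> exists (U : set T) (rho : T -> R),
    [/\ open U, U x, defining_function U rho &
      forall W, open W -> W `<=` U -> forall X Y,
        smooth_vfield W X -> smooth_vfield W Y ->
        exists2 Z, smooth_vfield W Z &
          forall p, W p -> interior_part p ->
            Z p = proj_change nabla
                    (fun q v => diff_at rho q v / (alpha * rho q)) X Y p].

(* By existence and uniqueness of the Levi-Civita connection of a
   pseudo-Riemannian metric, the quantifier ranges over exactly one connection
   (up to its values on non-smooth fields). *)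
Definition projectively_compact (alpha : R) (g : tensor2) :=
  forall nabla, levi_civita g nabla ->
    projectively_compact_connection alpha nabla.

End Manifold.

(* Main.v *)
(* Put m = 2 / alpha, S = rho^m and, for vector fields X and Y,
   N = nabla_X Y + (drho(X) Y + drho(Y) X) / (alpha rho).  The hypothesis on C
   gives dC = c drho + S d with smooth c and d.  Inserting
   g = h / S + C drho^2 / S^2 into the Koszul formula, all negative powers of
   rho can be collected into one unknown function t, so that
     h(N, Z) + t drho(Z) = F(Z) for all Z,    drho(N) - (S / C) t = G / C
   with F and G smooth up to the boundary.  The matrix of this linear system
   in (N, t), namely h bordered by drho with corner entry - S / C, is smooth up
   to the boundary, and at a boundary point it is invertible because h is
   nondegenerate on the kernel of drho.  By Cramer's rule N extends smoothly. *)
Require Import Defs.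
From mathcomp Require Import all_boot all_order all_algebra.
From mathcomp Require Import all_classical all_reals all_analysis.
From mathcomp Require Import ring lra.
Set Implicit Arguments.
Unset Strict Implicit.
Unset Printing Implicit Defensive.
Import Order.TTheory GRing.Theory Num.Theory.
Import numFieldNormedType.Exports.
Local Open Scope classical_set_scope.
Local Open Scope ring_scope.

(** * Smooth functions on subsets of the half-space *)

Section Calculus.
Context {R : realType} {n : nat}.
Implicit Types (f g : 'rV[R]_n.+1 -> R) (V A : set 'rV[R]_n.+1).
Implicit Types (x v : 'rV[R]_n.+1).

(** At a boundary point h may be degenerate on the full tangent space, so the Koszul formula cannot
    be solved for N by inverting h. The weight 1 / (alpha rho) is chosen for the following
    cancellation: dS is (2 / alpha) rho^(2/alpha - 1) drho, and the correction terms in N remove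
    every singular term of the Koszul formula except multiples of drho(Z). Those are absorbed in t =
    (C drho(N) - G) / S, a function with no a priori control at the boundary. Its definition,
    divided by C, is the last equation of the system, whence the corner entry. The solution of the
    system makes sense on the whole open set and is identified with N only where rho is nonzero, so
    no limit has to be taken.

    The fields (d_0 rho) d_k - (d_k rho) d_0 lie in the kernel of drho and produce c = d_0 C / d_0
    rho together with d. The division is allowed near the boundary point, since there drho is a
    nonzero multiple of the differential of coordinate 0.

    The exponent 2 / alpha is written [m.+1] in the code, and its integrality makes S smooth up to
    the boundary. *)

Lemma near_eq_differentiable (U W : normedModType R) (f g : U -> W) (x : U) :
  (\near x, f x = g x) -> differentiable f x -> differentiable g x.
Proof.
move=> fg df; have fgx := nbhs_singleton fg.
have fE (e : R) : 0 < e -> \forall y \near x,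
    `|f y - (f x + 'd f x (y - x))| <= e * `|y - x|.
  move=> e0; have /diffP[_ /funext] := df; rewrite lim_id//.
  by move/eqadd_some_oP => /(_ _ e0).
apply/diffP => /=.
(* The differential is a chosen map, so it suffices to exhibit one continuous linear approximation
   of [g]; the differential of [f] serves. *)
apply: (@getPex _ (fun (df : {linear U -> W}) => continuous df /\
  forall y, g y = g (lim (nbhs x)) + df (y - lim (nbhs x))
                  +o_(y \near x) (y - lim (nbhs x)))).
exists ('d f x); split; first exact: diff_continuous.
rewrite lim_id // -fgx.
have gE : g = (fun y => f x + 'd f x (y - x)) +o_ (nbhs_filter_on x) (fun y => y - x).
  apply/eqaddoP => e e0.
  near=> y; rewrite -[(g - _) y]/(g y - _).
  have <- : f y = g y by near: y.
  by near: y; exact: fE.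
by move=> y; rewrite {1}gE.
Unshelve. all: by end_near. Qed.

Lemma differentiable_row (U : normedModType R) (Phi : U -> 'rV[R]_n.+1) (x : U) :
  (forall l, differentiable (fun y => Phi y 0 l) x) -> differentiable Phi x.
Proof.
move=> d.
have -> : Phi = \sum_(l < n.+1) (fun y => Phi y 0 l *: (delta_mx 0 l : 'rV[R]_n.+1)).
  by apply/funext => y; rewrite fct_sumE {1}(row_sum_delta (Phi y)).
by apply: differentiable_sum => l; exact: differentiableZl.
Qed.

Lemma derive_comp_row f (Phi : 'rV[R]_n.+1 -> 'rV[R]_n.+1) x v :
  (forall l, differentiable (fun y => Phi y 0 l) x) ->
  differentiable f (Phi x) ->
  'D_v (f \o Phi) x = \sum_l 'D_(delta_mx 0 l) f (Phi x) * 'D_v (fun y => Phi y 0 l) x.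
Proof.
move=> dPl df; have dP := differentiable_row dPl.
rewrite deriveE; last exact: differentiable_comp.
rewrite diff_comp//= -[in 'd Phi x v]deriveE//.
have -> : 'D_v Phi x = \sum_l 'D_v (fun y => Phi y 0 l) x *: delta_mx 0 l.
  rewrite [in LHS](_ : Phi =
      \sum_(l < n.+1) (fun y => Phi y 0 l *: (delta_mx 0 l : 'rV[R]_n.+1))).
    rewrite derive_sum => [|l]; last first.
      by apply: diff_derivable; exact: differentiableZl.
    apply: eq_bigr => l _; rewrite deriveE; last exact: differentiableZl.
    by rewrite diffZl// deriveE.
  by apply/funext => y; rewrite fct_sumE {1}(row_sum_delta (Phi y)).
rewrite linear_sum; apply: eq_bigr => l _.
by rewrite linearZ [in 'D_(delta_mx 0 l) f (Phi x)](deriveE _ df) mulrC.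
Qed.

Lemma times_differentiable_ext k V f g : open V ->
  (forall y, V y -> f y = g y) ->
  times_differentiable k V f -> times_differentiable k V g.
Proof.
elim: k f g => [//|k IH] f g oV fg [df Df]; split.
  move=> x Vx; apply: near_eq_differentiable (df _ Vx).
  by apply: filterS (open_nbhs_nbhs (conj oV Vx)) => y /fg.
move=> v; apply: IH (Df v) => // y Vy; apply: near_eq_derive.
by apply: filterS (open_nbhs_nbhs (conj oV Vy)) => z /fg.
Qed.

Lemma times_differentiableW k V f :
  times_differentiable k.+1 V f -> times_differentiable k V f.
Proof.
elim: k f => [//|k IH] f [df Df]; split=> // v.
by apply: IH; exact: Df.
Qed.

Lemma times_differentiable_sub k V V' f : V' `<=` V ->
  times_differentiable k V f -> times_differentiable k V' f.
Proof.
move=> V'V; elim: k f => [//|k IH] f [df Df]; split=> [x /V'V/df//|v].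
exact: IH (Df v).
Qed.

Lemma times_differentiable_cst k V (c : R) : times_differentiable k V (cst c).
Proof.
elim: k c => [//|k IH] c; split=> [x _|v]; first exact: differentiable_cst.
rewrite (_ : 'D_v (cst c) = cst 0); first exact: IH.
by apply/funext => x; rewrite derive_cst.
Qed.

Lemma times_differentiableD k V f g : open V ->
  times_differentiable k V f -> times_differentiable k V g ->
  times_differentiable k V (f + g).
Proof.
move=> oV; elim: k f g => [//|k IH] f g [df Df] [dg Dg]; split=> [x Vx|v].
  by apply: differentiableD; [exact: df|exact: dg].
apply: times_differentiable_ext (IH _ _ (Df v) (Dg v)) => // x Vx.
by rewrite deriveD//; apply: diff_derivable; [exact: df|exact: dg].
Qed.

Lemma times_differentiableM k V f g : open V ->
  times_differentiable k V f -> times_differentiable k V g ->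
  times_differentiable k V (f * g).
Proof.
move=> oV; elim: k f g => [//|k IH] f g df dg; split=> [x Vx|v].
  by apply: differentiableM; [exact: df.1|exact: dg.1].
apply: (@times_differentiable_ext _ _ (f * 'D_v g + g * 'D_v f)) => //.
  move=> x Vx.
  by rewrite deriveM//; apply: diff_derivable; [exact: df.1|exact: dg.1].
apply: times_differentiableD => //; apply: IH.
- exact: times_differentiableW.
- exact: dg.2.
- exact: times_differentiableW.
- exact: df.2.
Qed.

Lemma times_differentiable_sum k V (F : 'I_n.+1 -> 'rV[R]_n.+1 -> R) : open V ->
  (forall l, times_differentiable k V (F l)) ->
  times_differentiable k V (\sum_l F l).
Proof.
move=> oV dF; elim/big_ind : _ => [|f g df dg|l _]; last exact: dF.
- exact: times_differentiable_cst.
- exact: times_differentiableD.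
Qed.

Lemma times_differentiableV k V f : open V -> (forall x, V x -> f x != 0) ->
  times_differentiable k V f -> times_differentiable k V (fun x => (f x)^-1).
Proof.
move=> oV f0; elim: k => [//|k IH] df; split=> [x Vx|v].
  by apply: differentiableV; [exact: df.1|exact: f0].
have dfV := IH (times_differentiableW df).
apply: (@times_differentiable_ext _ _
  (cst (-1) * (((fun x => (f x)^-1) * (fun x => (f x)^-1)) * 'D_v f))) => //.
  move=> x Vx; rewrite deriveV ?f0//; last exact/diff_derivable/df.1.
  by rewrite -[LHS]/(-1 * (((f x)^-1 * (f x)^-1) * _)) mulN1r expr2 invfM scaleNr.
apply: times_differentiableM => //; first exact: times_differentiable_cst.
apply: times_differentiableM => //; first exact: times_differentiableM.
exact: df.2.
Qed.

Lemma times_differentiable_comp k V V' f (Phi : 'rV[R]_n.+1 -> 'rV[R]_n.+1) :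
  open V -> (forall x, V x -> V' (Phi x)) ->
  (forall l, times_differentiable k V (fun x => Phi x 0 l)) ->
  times_differentiable k V' f -> times_differentiable k V (f \o Phi).
Proof.
move=> oV VV'; elim: k f => [//|k IH] f dP df; split=> [x Vx|v].
  apply: differentiable_comp; last by apply: df.1; exact: VV'.
  by apply: differentiable_row => l; apply: (dP l).1.
apply: (@times_differentiable_ext _ _
  (\sum_l ('D_(delta_mx 0 l) f \o Phi) * 'D_v (fun y => Phi y 0 l))) => //.
  move=> x Vx; rewrite derive_comp_row ?fct_sumE//; first by move=> l; apply: (dP l).1.
  by apply: df.1; exact: VV'.
apply: times_differentiable_sum => // l; apply: times_differentiableM => //.
  apply: IH => [m|]; last exact: df.2.
  exact: times_differentiableW.
exact: (dP l).2.
Qed.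

Lemma C_infty_deriv V f v : C_infty V f -> C_infty V ('D_v f).
Proof. by move=> df k; apply: (df k.+1).2. Qed.

Lemma C_infty_differentiable V f x : C_infty V f -> V x -> differentiable f x.
Proof. by move=> df; apply: (df 1).1. Qed.

End Calculus.

(** * Local smooth extensions and one-sided partial derivatives *)

Section SmoothOn.
Context {R : realType} {n : nat}.
Implicit Types (f g : 'rV[R]_n.+1 -> R) (V A B O : set 'rV[R]_n.+1).
Implicit Types (x v : 'rV[R]_n.+1).

(** The shape of chart images. From any point of such a set a short move in a nonnegative coordinate
    direction stays inside, which is all that the one-sided [partial] uses. *)
Definition rel_open A := exists2 O, open O & A = O `&` half_space.

Lemma smooth_on_ext A f g : (forall x, A x -> f x = g x) ->
  smooth_on A f -> smooth_on A g.
Proof.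
move=> fg sf x /[dup] Ax /sf[V [F [oV Vx dF Ff]]]; exists V, F; split=> // y Ay Vy.
by rewrite Ff// fg.
Qed.

Lemma smooth_on_sub A B f : B `<=` A -> smooth_on A f -> smooth_on B f.
Proof.
move=> BA sf x /BA /sf[V [F [oV Vx dF Ff]]]; exists V, F; split=> // y /BA Ay.
exact: Ff.
Qed.

Lemma smooth_on_local A f :
  (forall x, A x -> exists2 O, open O & O x /\ smooth_on (A `&` O) f) ->
  smooth_on A f.
Proof.
move=> loc x /[dup] Ax /loc[Q oQ [Qx /(_ _ (conj Ax Qx))[V [F [oV Vx dF Ff]]]]].
exists (V `&` Q), F; split=> //; first exact: openI.
  by move=> k; apply: times_differentiable_sub (dF k) => y [].
by move=> y Ay [Vy Qy]; apply: Ff.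
Qed.

Lemma smooth_on_cst A (c : R) : smooth_on A (fun=> c).
Proof.
move=> x _; exists setT, (cst c); split=> //; first exact: openT.
by move=> k; exact: times_differentiable_cst.
Qed.

Lemma smooth_onD A f g : smooth_on A f -> smooth_on A g ->
  smooth_on A (fun x => f x + g x).
Proof.
move=> sf sg x Ax; have [V [F [oV Vx dF Ff]]] := sf x Ax.
have [V' [G [oV' V'x dG Gg]]] := sg x Ax.
exists (V `&` V'), (F + G); split=> //; first exact: openI.
  move=> k; apply: times_differentiableD; first exact: openI.
    by apply: times_differentiable_sub (dF k) => y [].
  by apply: times_differentiable_sub (dG k) => y [].
by move=> y Ay [Vy V'y]; rewrite -Ff// -Gg.
Qed.

Lemma smooth_onM A f g : smooth_on A f -> smooth_on A g ->
  smooth_on A (fun x => f x * g x).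
Proof.
move=> sf sg x Ax; have [V [F [oV Vx dF Ff]]] := sf x Ax.
have [V' [G [oV' V'x dG Gg]]] := sg x Ax.
exists (V `&` V'), (F * G); split=> //; first exact: openI.
  move=> k; apply: times_differentiableM; first exact: openI.
    by apply: times_differentiable_sub (dF k) => y [].
  by apply: times_differentiable_sub (dG k) => y [].
by move=> y Ay [Vy V'y]; rewrite -Ff// -Gg.
Qed.

Lemma smooth_onV A f : (forall x, A x -> f x != 0) -> smooth_on A f ->
  smooth_on A (fun x => (f x)^-1).
Proof.
move=> f0 sf x Ax; have [V [F [oV Vx dF Ff]]] := sf x Ax.
pose V' := V `&` (F @^-1` [set y | y != 0]).
have oV' : open V'.
  rewrite openE => y [Vy Fy]; apply: filterI.
    exact: open_nbhs_nbhs.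
  have cF := differentiable_continuous (C_infty_differentiable dF Vy).
  by apply: cF; apply: open_nbhs_nbhs; split=> //; exact: open_neq.
exists V', (fun x => (F x)^-1); split=> //.
- by split=> //=; rewrite Ff// f0.
- move=> k; apply: times_differentiableV => // [y []//|].
  by apply: times_differentiable_sub (dF k) => y [].
- by move=> y Ay [Vy V'y]; rewrite -Ff.
Qed.

(** The components of [phi] extend on different neighborhoods. On their finite intersection the
    extensions form a map [Phi]; since [Phi] may leave [V] away from [A], the domain is cut down
    once more by the preimage of [V]. *)
Lemma smooth_on_comp A B f (phi : 'rV[R]_n.+1 -> 'rV[R]_n.+1) :
  (forall l, smooth_on A (fun x => phi x 0 l)) ->
  (forall x, A x -> B (phi x)) ->
  smooth_on B f -> smooth_on A (f \o phi).
Proof.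
move=> sphi AB sf x Ax; have [V [F [oV Vx dF Ff]]] := sf _ (AB _ Ax).
have /choice[VV /choice[PP HP]] := fun l => sphi l x Ax.
pose Phi y : 'rV[R]_n.+1 := \row_l PP l y.
pose V1 := \bigcap_(l in [set: 'I_n.+1]) VV l.
have oV1 : open V1.
  rewrite openE => y V1y; rewrite /interior /V1.
  have : \forall z \near y, forall l, VV l z.
    apply: (@filter_forall _ 'I_n.+1 (fun l => VV l) (nbhs y)) => l.
    have [oVl _ _ _] := HP l.
    exact: (open_nbhs_nbhs (conj oVl (V1y l I))).
  by apply: filterS => z Vz l _.
have dPhi l k : times_differentiable k V1 (fun x => Phi x 0 l).
  rewrite (_ : (fun x => _) = PP l); last by apply/funext => y; rewrite mxE.
  have [_ _ dP _] := HP l.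
  by apply: times_differentiable_sub (dP k) => y; apply.
have cPhi y : V1 y -> {for y, continuous Phi}.
  move=> V1y; apply: differentiable_continuous.
  by apply: differentiable_row => l; exact: (dPhi l 1).1.
pose V' := V1 `&` (Phi @^-1` V).
have oV' : open V'.
  rewrite openE => y [V1y Vy]; apply: filterI; first exact: open_nbhs_nbhs.
  by apply: cPhi => //; exact: open_nbhs_nbhs.
have Pphi y : A y -> V1 y -> Phi y = phi y.
  move=> Ay V1y; apply/rowP => l; rewrite mxE.
  by have [_ _ _ ->] := HP l; last exact: V1y.
have V1x : V1 x by move=> l _; have [] := HP l.
exists V', (F \o Phi); split=> //.
- by split=> //=; rewrite Pphi.
- move=> k; apply: (@times_differentiable_comp _ _ _ _ V) => // [y []//|l].
  by apply: times_differentiable_sub (dPhi l k) => y [].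
- by move=> y Ay [V1y /= Vy]; rewrite Pphi// Ff//; [exact: AB|rewrite -Pphi].
Qed.

Lemma half_space_scale x k (t : R) : half_space x -> 0 <= t ->
  half_space (x + t *: delta_mx 0 k).
Proof. by move=> hx t0; rewrite /half_space/= !mxE addr_ge0 ?mulr_ge0. Qed.

Lemma near_line O x v : open O -> O x -> \forall t \near (0 : R)^'+, O (x + t *: v).
Proof.
move=> oO Ox; apply: cvg_within.
have : (fun t : R => x + t *: v) @ 0 --> x + 0 *: v.
  by apply: cvgD; [exact: cvg_cst|apply: cvgZl; exact: cvg_id].
rewrite scale0r addr0; apply; exact: open_nbhs_nbhs.
Qed.

Lemma cvg_right_derive f x v : differentiable f x ->
  (fun t : R => t^-1 * (f (x + t *: v) - f x)) @ 0^'+ --> 'D_v f x.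
Proof.
move=> df.
pose F (h : R) := h^-1 *: ((f \o shift x) (h *: v) - f x).
have /= H : F @ 0^' --> 'D_v f x.
  exact: diff_derivable.
rewrite (_ : (fun t => _) = F); last first.
  by apply/funext => h; rewrite /F /= (addrC x).
move=> A /H /nbhs_ballP [_ /posnumP[e] xe_A].
by exists e%:num => //= y xe_y /gt_eqF/negbT/xe_A; exact.
Qed.

(** For t >= 0 the point x + t e_k stays in the half-space, so the one-sided difference quotient
    only evaluates [f] on [A] and agrees with that of the extension. The rules of calculus for
    [partial] are pulled back from ['D_v] through this identity. *)
Lemma partialE A V (F f : 'rV[R]_n.+1 -> R) k x : rel_open A -> A x -> open V -> V x ->
  C_infty V F -> (forall y, A y -> V y -> F y = f y) ->
  partial k f x = 'D_(delta_mx 0 k) F x.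
Proof.
move=> [Q oQ AE] Ax oV Vx dF Ff.
have dFx := C_infty_differentiable dF Vx.
apply: cvg_lim => //; apply: cvg_trans (cvg_right_derive (v := delta_mx 0 k) dFx).
have [Qx Hx] : (Q `&` half_space) x by rewrite -AE.
apply: near_eq_cvg; near=> t.
rewrite !Ff//.
  rewrite AE; split; first by near: t; exact: near_line.
  by apply: half_space_scale => //; near: t; exact: nbhs_right_ge.
by near: t; exact: near_line.
Unshelve. all: by end_near. Qed.

Lemma smooth_on_partial A f k : rel_open A -> smooth_on A f ->
  smooth_on A (partial k f).
Proof.
move=> oA sf x Ax; have [V [F [oV Vx dF Ff]]] := sf x Ax.
exists V, ('D_(delta_mx 0 k) F); split=> //; first exact: C_infty_deriv.
by move=> y Ay Vy; rewrite (partialE (V := V) (F := F) k oA).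
Qed.

Lemma partial_eq A f g k x : rel_open A -> A x -> (forall y, A y -> f y = g y) ->
  partial k f x = partial k g x.
Proof.
move=> [Q oQ AE] Ax fg.
have [Qx Hx] : (Q `&` half_space) x by rewrite -AE.
have H : \forall t \near (0 : R)^'+, A (x + t *: delta_mx 0 k).
  near=> t; rewrite AE; split; first by near: t; exact: near_line.
  by apply: half_space_scale => //; near: t; exact: nbhs_right_ge.
rewrite /partial (fg x)//; congr (lim _); rewrite eqEsubset.
split; apply: near_eq_cvg; apply: filterS H => t At; by rewrite fg.
Unshelve. all: by end_near. Qed.

Lemma partial_cst (c : R) k (x : 'rV[R]_n.+1) : partial k (fun=> c) x = 0.
Proof.
by apply: cvg_lim => //; apply: cvg_near_cst; apply: nearW => t; rewrite subrr mulr0.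
Qed.

Lemma partial_coord k l (x : 'rV[R]_n.+1) : partial k (fun y => y 0 l) x = (k == l)%:R.
Proof.
apply: cvg_lim => //; apply: cvg_near_cst; near=> t.
have t0 : t != 0 by apply: lt0r_neq0; near: t; exact: nbhs_right_gt.
by rewrite !mxE eqxx /= eq_sym addrAC subrr add0r mulKf.
Unshelve. all: by end_near. Qed.

Lemma partialD A f g k x : rel_open A -> A x -> smooth_on A f -> smooth_on A g ->
  partial k (fun y => f y + g y) x = partial k f x + partial k g x.
Proof.
move=> oA Ax sf sg; have [V [F [oV Vx dF Ff]]] := sf x Ax.
have [V' [G [oV' V'x dG Gg]]] := sg x Ax.
have oVV := openI oV oV'.
have dF' : C_infty (V `&` V') F.
  by move=> k'; apply: times_differentiable_sub (dF k') => y [].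
have dG' : C_infty (V `&` V') G.
  by move=> k'; apply: times_differentiable_sub (dG k') => y [].
rewrite (partialE k oA Ax oV Vx dF Ff) (partialE k oA Ax oV' V'x dG Gg).
rewrite (@partialE A (V `&` V') (F + G))//.
- by apply: deriveD; apply: diff_derivable; exact: C_infty_differentiable.
- by move=> j; apply: times_differentiableD.
- by move=> y Ay [Vy V'y]; rewrite -Ff// -Gg.
Qed.

Lemma partialM A f g k x : rel_open A -> A x -> smooth_on A f -> smooth_on A g ->
  partial k (fun y => f y * g y) x = f x * partial k g x + g x * partial k f x.
Proof.
move=> oA Ax sf sg; have [V [F [oV Vx dF Ff]]] := sf x Ax.
have [V' [G [oV' V'x dG Gg]]] := sg x Ax.
have oVV := openI oV oV'.
have dF' : C_infty (V `&` V') F.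
  by move=> k'; apply: times_differentiable_sub (dF k') => y [].
have dG' : C_infty (V `&` V') G.
  by move=> k'; apply: times_differentiable_sub (dG k') => y [].
rewrite (partialE k oA Ax oV Vx dF Ff) (partialE k oA Ax oV' V'x dG Gg).
rewrite -(Ff x)// -(Gg x)// (@partialE A (V `&` V') (F * G))//.
- by apply: deriveM; apply: diff_derivable; exact: C_infty_differentiable.
- by move=> j; apply: times_differentiableM.
- by move=> y Ay [Vy V'y]; rewrite -Ff// -Gg.
Qed.

Lemma partial_comp A B f (phi : 'rV[R]_n.+1 -> 'rV[R]_n.+1) k x :
  rel_open A -> rel_open B -> A x -> (forall y, A y -> B (phi y)) ->
  (forall l, smooth_on A (fun y => phi y 0 l)) -> smooth_on B f ->
  partial k (f \o phi) x =
    \sum_l partial k (fun y => phi y 0 l) x * partial l f (phi x).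
Proof.
move=> oA oB Ax AB sphi sf; have Bx := AB _ Ax.
have [V [F [oV Vx dF Ff]]] := sf _ Bx.
have /choice[VV /choice[PP HP]] := fun l => sphi l x Ax.
pose Phi y : 'rV[R]_n.+1 := \row_l PP l y.
have dP l : differentiable (PP l) x.
  by have [_ Wx dW _] := HP l; exact: C_infty_differentiable Wx.
have PhiE l : (fun y => Phi y 0 l) = PP l by apply/funext => y; rewrite mxE.
have dPhi : differentiable Phi x.
  by apply: differentiable_row => l; rewrite PhiE.
have Phix : Phi x = phi x.
  by apply/rowP => l; rewrite mxE; have [_ Wx _ ->] := HP l.
have oAx : \forall t \near (0 : R)^'+, A (x + t *: delta_mx 0 k).
  case: oA => [Q oQ AE]; have [Qx Hx] : (Q `&` half_space) x by rewrite -AE.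
  near=> t; rewrite AE; split; first by near: t; exact: near_line.
  by apply: half_space_scale => //; near: t; exact: nbhs_right_ge.
have dF' : differentiable F (Phi x).
  by rewrite Phix; exact: C_infty_differentiable dF _.
have -> : partial k (f \o phi) x = 'D_(delta_mx 0 k) (F \o Phi) x.
  apply: cvg_lim => //.
  have dFPhi := differentiable_comp dPhi dF'.
  apply: cvg_trans (cvg_right_derive (v := delta_mx 0 k) dFPhi).
  have nPhi : \forall t \near (0 : R)^'+,
      Phi (x + t *: delta_mx 0 k) = phi (x + t *: delta_mx 0 k).
    have : \forall t \near (0 : R)^'+, forall l, VV l (x + t *: delta_mx 0 k).
      apply: (@filter_forall _ 'I_n.+1 (fun l t => VV l (x + t *: delta_mx 0 k))) => l.
      by have [oW Wx _ _] := HP l; exact: near_line.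
    apply: filterS2 oAx => t At Wt; apply/rowP => l; rewrite mxE.
    by have [_ _ _ ->] := HP l.
  have nV : \forall t \near (0 : R)^'+, V (Phi (x + t *: delta_mx 0 k)).
    have c : (fun t : R => x + t *: delta_mx 0 k) @ 0 -->
        x + 0 *: (delta_mx 0 k : 'rV[R]_n.+1).
      by apply: cvgD; [exact: cvg_cst|apply: cvgZl; exact: cvg_id].
    rewrite scale0r addr0 in c.
    have nV : \forall y \near x, V (Phi y).
      apply: (differentiable_continuous dPhi).
      by apply: open_nbhs_nbhs; rewrite Phix.
    by apply: cvg_within; exact: (c _ nV).
  apply: near_eq_cvg; near=> t.
  have At : A (x + t *: delta_mx 0 k) by near: t.
  have Vt : V (Phi (x + t *: delta_mx 0 k)) by near: t.
  have Pt : Phi (x + t *: delta_mx 0 k) = phi (x + t *: delta_mx 0 k) by near: t.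
  rewrite /= Phix Pt Ff//; last by rewrite -Pt.
    by rewrite Ff.
  exact: AB.
rewrite derive_comp_row//; last by move=> l; rewrite PhiE.
apply: eq_bigr => l _; rewrite mulrC PhiE Phix (partialE l oB Bx oV Vx dF Ff).
by congr (_ * _); have [oW Wx dW Pp] := HP l; rewrite (partialE k oA Ax oW Wx dW Pp).
Unshelve. all: by end_near. Qed.

Lemma smooth_on_continuous A f x : smooth_on A f -> A x ->
  f y @[y --> within A (nbhs x)] --> f x.
Proof.
move=> sf Ax; have [V [F [oV Vx dF Ff]]] := sf x Ax.
have cF := differentiable_continuous (C_infty_differentiable dF Vx).
rewrite -(Ff x)//; apply: (@cvg_trans _ (F y @[y --> within A (nbhs x)])).
  apply: near_eq_cvg; rewrite near_withinE; near=> y => Ay.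
  by apply: Ff => //; near: y; exact: open_nbhs_nbhs.
exact: cvg_within_filter.
Unshelve. all: by end_near. Qed.

End SmoothOn.

(** * Calculus in a chart *)

Section ManifoldCalculus.
Context {R : realType} {n : nat} {T : topologicalType} (M : bmanifold R n T).
Implicit Types (i j : Defs.index M) (W : set T) (f g : T -> R) (p : T).

Lemma chart_open i (Q : set 'rV[R]_n.+1) : open Q -> open (dom i `&` chart i @^-1` Q).
Proof.
move=> oQ; rewrite openE => p [ip Qp].
have /subspace_continuousP/(_ p ip) c := @chart_continuous _ _ _ M i.
have nQ : nbhs (chart i p) Q by exact: open_nbhs_nbhs.
have := c _ nQ; rewrite /nbhs/= /within/= => H.
have Hd : nbhs p (dom i) by apply: open_nbhs_nbhs; split => //; exact: dom_open.
by move: H Hd; apply: filterS2 => q /[swap] iq /(_ iq).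
Qed.

Lemma chart_img i W : open W -> rel_open (chart i @` (W `&` dom i)).
Proof.
move=> oW; have [Q oQ QE] := @chart_img_open _ _ _ M i.
(* Continuity of [chart_inv] within the chart image only gives relative neighborhoods; the
   implication inside the set turns them into neighborhoods in the full space. *)
exists (Q `&` (interior [set x | (chart i @` dom i) x -> W (chart_inv i x)])).
  by apply: openI => //; exact: open_interior.
apply/seteqP; split=> x.
  move=> [p [Wp ip] <-].
  have A0 : (chart i @` dom i) (chart i p) by exists p.
  have := A0; rewrite {1}QE => -[Qx Hx]; split=> //; split=> //.
  have /subspace_continuousP/(_ _ A0) c := @chart_inv_continuous _ _ _ M i.
  have nW : nbhs (chart_inv i (chart i p)) W by rewrite chartK//; exact: open_nbhs_nbhs.
  exact: (c _ nW).
move=> [[Qx Wx] Hx].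
have A0 : (chart i @` dom i) x by rewrite QE.
have := interior_subset Wx => /(_ A0); case: A0 => p ip <-.
by rewrite chartK// => Wp; exists p.
Qed.

Lemma chart_imgW i W x : (chart i @` (W `&` dom i)) x ->
  [/\ W (chart_inv i x), dom i (chart_inv i x) & chart i (chart_inv i x) = x].
Proof. by move=> [p [Wp ip] <-]; rewrite chartK. Qed.

Lemma smooth_fun_ext W f g : (forall p, W p -> f p = g p) ->
  smooth_fun M W f -> smooth_fun M W g.
Proof.
move=> fg sf i; apply: smooth_on_ext (sf i) => x /chart_imgW[Wx ix xE].
exact: fg.
Qed.

Lemma smooth_fun_sub W W' f : W' `<=` W -> smooth_fun M W f -> smooth_fun M W' f.
Proof.
by move=> W'W sf i; apply: smooth_on_sub (sf i) => _ [p [/W'W Wp ip] <-]; exists p.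
Qed.

Lemma smooth_fun_local W f :
  (forall p, W p -> exists W', [/\ open W', W' p & smooth_fun M (W `&` W') f]) ->
  smooth_fun M W f.
Proof.
move=> loc i; apply: smooth_on_local => _ [p [Wp ip] <-].
have [W' [oW' W'p sf]] := loc p Wp.
have [Q oQ QE] := chart_img i oW'; exists Q => //; split.
  suff : (Q `&` half_space) (chart i p) by case.
  by rewrite -QE; exists p.
apply: smooth_on_sub (sf i) => _ [[q [Wq iq] <-] Qq]; exists q => //.
split=> //; split=> //.
have : (Q `&` half_space) (chart i q).
  split=> //; have [Q' _ Q'E] := @chart_img_open _ _ _ M i.
  suff : (Q' `&` half_space) (chart i q) by case.
  by rewrite -Q'E; exists q.
by rewrite -QE => /chart_imgW[]; rewrite chartK.
Qed.

Lemma smooth_fun_cst W (c : R) : smooth_fun M W (fun=> c).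
Proof. by move=> i; exact: smooth_on_cst. Qed.

Lemma smooth_funD W f g : smooth_fun M W f -> smooth_fun M W g ->
  smooth_fun M W (fun p => f p + g p).
Proof. by move=> sf sg i; apply: (smooth_onD (sf i) (sg i)). Qed.

Lemma smooth_funM W f g : smooth_fun M W f -> smooth_fun M W g ->
  smooth_fun M W (fun p => f p * g p).
Proof. by move=> sf sg i; apply: (smooth_onM (sf i) (sg i)). Qed.

Lemma smooth_funN W f : smooth_fun M W f -> smooth_fun M W (fun p => - f p).
Proof.
move=> sf; apply: (smooth_fun_ext _ (smooth_funM (@smooth_fun_cst W (-1)) sf)) => p _.
by rewrite mulN1r.
Qed.

Lemma smooth_funB W f g : smooth_fun M W f -> smooth_fun M W g ->
  smooth_fun M W (fun p => f p - g p).
Proof. by move=> sf sg; apply: smooth_funD => //; exact: smooth_funN. Qed.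

Lemma smooth_funV W f : (forall p, W p -> f p != 0) -> smooth_fun M W f ->
  smooth_fun M W (fun p => (f p)^-1).
Proof.
move=> f0 sf i; apply: (smooth_onV _ (sf i)) => x /chart_imgW[Wx _ _].
exact: f0.
Qed.

Lemma smooth_funX W f k : smooth_fun M W f -> smooth_fun M W (fun p => f p ^+ k).
Proof.
move=> sf; elim: k => [|k IH]; first exact: smooth_fun_cst.
by apply: (smooth_fun_ext _ (smooth_funM sf IH)) => p _; rewrite exprS.
Qed.

Lemma smooth_fun_sum (I : Type) (r : seq I) (P : pred I) W (F : I -> T -> R) :
  (forall k, smooth_fun M W (F k)) ->
  smooth_fun M W (fun p => \sum_(k <- r | P k) F k p).
Proof.
move=> sF; elim: r => [|a r IH].
  by apply: (smooth_fun_ext _ (@smooth_fun_cst W 0)) => p _; rewrite big_nil.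
case Pa : (P a).
  apply: (smooth_fun_ext _ (smooth_funD (sF a) IH)) => p _.
  by rewrite big_cons Pa.
by apply: smooth_fun_ext IH => p _; rewrite big_cons Pa.
Qed.

Lemma smooth_fun_prod (I : Type) (r : seq I) (P : pred I) W (F : I -> T -> R) :
  (forall k, smooth_fun M W (F k)) ->
  smooth_fun M W (fun p => \prod_(k <- r | P k) F k p).
Proof.
move=> sF; elim: r => [|a r IH].
  by apply: (smooth_fun_ext _ (@smooth_fun_cst W 1)) => p _; rewrite big_nil.
case Pa : (P a).
  apply: (smooth_fun_ext _ (smooth_funM (sF a) IH)) => p _.
  by rewrite big_cons Pa.
by apply: smooth_fun_ext IH => p _; rewrite big_cons Pa.
Qed.

Lemma smooth_fun_coord j l : smooth_fun M (dom j) (fun p => chart j p 0 l).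
Proof. by move=> i; rewrite setIC; exact: chart_compatible. Qed.

(** Smoothness in a single chart suffices: in any other chart the function is precomposed with a
    smooth transition map. *)
Lemma smooth_fun_chart i W f : W `<=` dom i ->
  smooth_on (chart i @` W) (f \o chart_inv i) -> smooth_fun M W f.
Proof.
move=> Wi sf j.
apply: (@smooth_on_ext _ _ _ ((f \o chart_inv i) \o (chart i \o chart_inv j))).
  by move=> x /chart_imgW[Wx jx xE]; rewrite /= chartK//; exact: Wi.
apply: (smooth_on_comp _ _ sf) => [l|x /chart_imgW[Wx jx xE]].
  apply: smooth_on_sub (chart_compatible (b := M) (i := j) (j := i) l).
  by move=> _ [p [Wp jp] <-]; exists p => //; split=> //; exact: Wi.
by exists (chart_inv j x).
Qed.

Definition pderiv i (k : 'I_n.+1) f p := partial k (f \o chart_inv i) (chart i p).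

Lemma smooth_pderiv i k W f : open W -> W `<=` dom i -> smooth_fun M W f ->
  smooth_fun M W (pderiv i k f).
Proof.
move=> oW Wi sf; apply: (smooth_fun_chart Wi).
have WE : W = W `&` dom i by rewrite setIidl.
rewrite WE; have := smooth_on_partial k (chart_img i oW) (sf i).
by apply: smooth_on_ext => x /chart_imgW[Wx jx xE]; rewrite /pderiv /= xE.
Qed.

Lemma pderiv_eq i k W f g p : open W -> W p -> dom i p ->
  (forall q, W q -> f q = g q) -> pderiv i k f p = pderiv i k g p.
Proof.
move=> oW Wp ip fg; apply: (partial_eq _ (chart_img i oW)); first by exists p.
by move=> x /chart_imgW[Wx _ _]; exact: fg.
Qed.

Lemma pderiv_cst i k (c : R) p : pderiv i k (fun=> c) p = 0.
Proof. exact: partial_cst. Qed.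

Lemma pderiv_coord i k l p : dom i p -> 
  pderiv i k (fun q => chart i q 0 l) p = (k == l)%:R.
Proof.
move=> ip; rewrite -(partial_coord k l (chart i p)).
apply: (partial_eq _ (chart_img i (@openT T))); first by exists p.
by move=> x /chart_imgW[_ _ xE]; rewrite /= xE.
Qed.

Lemma pderivD i k W f g p : open W -> W p -> dom i p ->
  smooth_fun M W f -> smooth_fun M W g ->
  pderiv i k (fun q => f q + g q) p = pderiv i k f p + pderiv i k g p.
Proof.
move=> oW Wp ip sf sg.
by apply: (partialD _ (chart_img i oW) _ (sf i) (sg i)); exists p.
Qed.

Lemma pderivM i k W f g p : open W -> W p -> dom i p ->
  smooth_fun M W f -> smooth_fun M W g ->
  pderiv i k (fun q => f q * g q) p = f p * pderiv i k g p + g p * pderiv i k f p.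
Proof.
move=> oW Wp ip sf sg.
have := @partialM _ _ _ (f \o chart_inv i) (g \o chart_inv i) k (chart i p)
  (chart_img i oW) _ (sf i) (sg i).
by rewrite /= chartK//; apply; exists p.
Qed.

Lemma pderiv_chain i j k W f p : open W -> W p -> dom i p -> dom j p ->
  smooth_fun M W f ->
  pderiv i k f p = \sum_l jac i j p k l * pderiv j l f p.
Proof.
move=> oW Wp ip jp sf.
pose W' := W `&` dom j.
have oW' : open W' by apply: openI => //; exact: dom_open.
have A : (chart i @` (W' `&` dom i)) (chart i p) by exists p.
transitivity (partial k ((f \o chart_inv j) \o (chart j \o chart_inv i)) (chart i p)).
  apply: (partial_eq _ (chart_img i oW')) => //.
  by move=> x /chart_imgW[[Wx jx] ix xE]; rewrite /= chartK.
rewrite (@partial_comp _ _ _ (chart j @` (W `&` dom j)) (f \o chart_inv j)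
  (chart j \o chart_inv i) k (chart i p) (chart_img i oW') (chart_img j oW) A).
- by apply: eq_bigr => l _; rewrite mxE /pderiv /= chartK.
- by move=> x /chart_imgW[[Wx jx] ix xE]; exists (chart_inv i x).
- move=> l; apply: smooth_on_sub (chart_compatible (b := M) (i := i) (j := j) l).
  by move=> _ [q [[Wq jq] iq] <-]; exists q.
- exact: sf.
Qed.

Lemma jacE i j p k l : jac i j p k l = pderiv i k (fun q => chart j q 0 l) p.
Proof. by rewrite mxE. Qed.

(** The chain rule applied to the coordinate functions of the third chart. *)
Lemma jacM i j l p : dom i p -> dom j p -> dom l p ->
  jac i j p *m jac j l p = jac i l p.
Proof.
move=> ip jp lp; apply/matrixP => a b; rewrite mxE jacE.
rewrite (@pderiv_chain i j a (dom l))//; [|exact: dom_open|exact: smooth_fun_coord].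
by apply: eq_bigr => m _; rewrite -jacE.
Qed.

Lemma jac_id i p : dom i p -> jac i i p = 1%:M.
Proof. by move=> ip; apply/matrixP => a b; rewrite jacE pderiv_coord// mxE. Qed.

Lemma mulmx_jacK i j p (v : 'rV[R]_n.+1) : dom i p -> dom j p ->
  v *m jac i j p *m jac j i p = v.
Proof. by move=> ip jp; rewrite -mulmxA jacM// jac_id// mulmx1. Qed.

(** The chart [chart_at M p] used by [diff_at] varies with [p] without any continuity. Here the
    differential is read in one fixed chart, where it can be differentiated again in [p]. *)
Lemma diff_atE i W f p v : open W -> W p -> dom i p -> smooth_fun M W f ->
  diff_at M f p v = \sum_l (v *m jac (chart_at M p) i p) 0 l * pderiv i l f p.
Proof.
move=> oW Wp ip sf; rewrite /diff_at.
under eq_bigr => k _ do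
  rewrite -/(pderiv _ k f p)
    (pderiv_chain k oW Wp (mem_chart_at M p) ip sf) big_distrr /=.
rewrite exchange_big /=; apply: eq_bigr => l _.
by rewrite mxE big_distrl /=; apply: eq_bigr => k _; rewrite mulrA.
Qed.

Lemma smooth_fun_continuous W f p : open W -> W p -> smooth_fun M W f ->
  {for p, continuous f}.
Proof.
move=> oW Wp sf; pose i := chart_at M p; have ip := mem_chart_at M p.
have A : (chart i @` (W `&` dom i)) (chart i p) by exists p.
have c := smooth_on_continuous (sf i) A; rewrite /= chartK// in c.
move=> B nB.
have H : nbhs (chart i p)
  [set y | (chart i @` (W `&` dom i)) y -> B (f (chart_inv i y))] by exact: (c _ nB).
rewrite nbhsE in H; case: H => Q [oQ Qp] QB.
have oQ' := chart_open i oQ.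
have : nbhs p ((dom i `&` chart i @^-1` Q) `&` W).
  by apply: open_nbhs_nbhs; split=> //; exact: openI.
apply: filterS => q [[iq Qq] Wq].
by have := QB _ Qq; rewrite /= chartK//; apply; exists q.
Qed.

End ManifoldCalculus.

(** * Vector fields and bilinear forms in a fixed chart *)

Section Fields.
Context {R : realType} {n : nat} {T : topologicalType} (M : bmanifold R n T).
Implicit Types (i j : Defs.index M) (W : set T) (f g : T -> R) (p : T).
Implicit Types (X Y : T -> 'rV[R]_n.+1) (v w : 'rV[R]_n.+1).

Definition smooth_row W (u : T -> 'rV[R]_n.+1) :=
  forall k, smooth_fun M W (fun p => u p 0 k).

(** The inverse of [vcomp i] over [dom i]: it passes from components in the fixed chart to the
    representation of fields by [chart_at]. *)
Definition of_chart i (u : T -> 'rV[R]_n.+1) : T -> 'rV[R]_n.+1 :=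
  fun p => u p *m jac i (chart_at M p) p.

Lemma vcomp_of_chart i u p : dom i p -> vcomp i (of_chart i u) p = u p.
Proof.
move=> ip; have cp := mem_chart_at M p.
by rewrite /vcomp /of_chart mulmx_jacK.
Qed.

Lemma of_chart_vcomp i X p : dom i p -> of_chart i (vcomp i X) p = X p.
Proof.
move=> ip; have cp := mem_chart_at M p.
by rewrite /vcomp /of_chart mulmx_jacK.
Qed.

Lemma smooth_of_chart i W u : open W -> W `<=` dom i -> smooth_row W u ->
  smooth_vfield M W (of_chart i u).
Proof.
move=> oW Wi su j k.
apply: (@smooth_fun_ext _ _ _ _ _
  (fun p => \sum_l u p 0 l * pderiv i l (fun q => chart j q 0 k) p)).
  move=> p [Wp jp]; have ip := Wi _ Wp; have cp := mem_chart_at M p.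
  rewrite /vcomp /of_chart -mulmxA jacM// mxE.
  by apply: eq_bigr => l _; rewrite jacE.
apply: smooth_fun_sum => l; apply: smooth_funM.
  by apply: smooth_fun_sub (su l) => p [].
apply: smooth_pderiv => [|p [/Wi]//|].
  by apply: openI => //; exact: dom_open.
by apply: smooth_fun_sub (@smooth_fun_coord _ _ _ M j k) => p [].
Qed.

Lemma smooth_vcomp i W X : W `<=` dom i -> smooth_vfield M W X ->
  smooth_row W (vcomp i X).
Proof. by move=> Wi sX k; have := sX i k; rewrite setIidl. Qed.

Lemma smooth_tcomp i W (g : T -> 'M[R]_n.+1) k l : W `<=` dom i ->
  smooth_tensor2 M W g -> smooth_fun M W (fun p => tcomp i g p k l).
Proof. by move=> Wi sX; have := sX i k l; rewrite setIidl. Qed.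

Definition vderiv i (u : 'rV[R]_n.+1) f p := \sum_l u 0 l * pderiv i l f p.

Lemma deriv_alongE i W X f p : open W -> W p -> dom i p -> smooth_fun M W f ->
  deriv_along M X f p = vderiv i (vcomp i X p) f p.
Proof. by move=> oW Wp ip sf; exact: diff_atE ip sf. Qed.

Lemma vderiv_delta i k f p : vderiv i (delta_mx 0 k) f p = pderiv i k f p.
Proof.
rewrite /vderiv (bigD1 k)//= big1 ?addr0 ?mxE ?eqxx ?mul1r// => l /negPf lk.
by rewrite mxE lk mul0r.
Qed.

Lemma vderiv_eq i W u f g p : open W -> W p -> dom i p ->
  (forall q, W q -> f q = g q) -> vderiv i u f p = vderiv i u g p.
Proof.
by move=> oW Wp ip fg; apply: eq_bigr => l _; rewrite (pderiv_eq _ oW Wp ip fg).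
Qed.

Lemma vderiv_cst i u (c : R) p : vderiv i u (fun=> c) p = 0.
Proof. by rewrite /vderiv big1// => l _; rewrite pderiv_cst mulr0. Qed.

Lemma vderiv_coord i u l p : dom i p -> vderiv i u (fun q => chart i q 0 l) p = u 0 l.
Proof.
move=> ip; rewrite /vderiv (bigD1 l)//= big1 ?addr0 => [|k /negPf kl].
  by rewrite pderiv_coord// eqxx mulr1.
by rewrite pderiv_coord// kl mulr0.
Qed.

Lemma vderivD i W u f g p : open W -> W p -> dom i p ->
  smooth_fun M W f -> smooth_fun M W g ->
  vderiv i u (fun q => f q + g q) p = vderiv i u f p + vderiv i u g p.
Proof.
move=> oW Wp ip sf sg; rewrite /vderiv -big_split; apply: eq_bigr => l _.
by rewrite (pderivD _ oW Wp ip sf sg) mulrDr.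
Qed.

Lemma vderivM i W u f g p : open W -> W p -> dom i p ->
  smooth_fun M W f -> smooth_fun M W g ->
  vderiv i u (fun q => f q * g q) p = f p * vderiv i u g p + g p * vderiv i u f p.
Proof.
move=> oW Wp ip sf sg; rewrite /vderiv !big_distrr -big_split; apply: eq_bigr => l _.
by rewrite (pderivM _ oW Wp ip sf sg) /=; ring.
Qed.

Lemma vderivX i W u f k p : open W -> W p -> dom i p -> smooth_fun M W f ->
  vderiv i u (fun q => f q ^+ k.+1) p = k.+1%:R * f p ^+ k * vderiv i u f p.
Proof.
move=> oW Wp ip sf; elim: k => [|k IH].
  by rewrite expr0 !mul1r; apply: (vderiv_eq _ oW Wp ip) => q _; rewrite expr1.
rewrite (vderiv_eq u oW Wp ip (g := fun q => f q * f q ^+ k.+1)); last first.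
  by move=> q _; rewrite exprS.
rewrite (vderivM _ oW Wp ip sf (smooth_funX k.+1 sf)) IH -[k.+2]addn1 natrD exprS.
ring.
Qed.

Lemma vderivZl i u (a : R) f p : vderiv i (a *: u) f p = a * vderiv i u f p.
Proof.
by rewrite /vderiv big_distrr; apply: eq_bigr => l _; rewrite mxE /= mulrA.
Qed.

Lemma vderivDl i u v f p : vderiv i (u + v) f p = vderiv i u f p + vderiv i v f p.
Proof.
by rewrite /vderiv -big_split; apply: eq_bigr => l _; rewrite mxE mulrDl.
Qed.

Lemma smooth_vderiv i W (u : T -> 'rV[R]_n.+1) f : open W -> W `<=` dom i ->
  smooth_row W u -> smooth_fun M W f -> smooth_fun M W (fun p => vderiv i (u p) f p).
Proof.
move=> oW Wi su sf; apply: smooth_fun_sum => l; apply: smooth_funM => //.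
exact: smooth_pderiv.
Qed.

Lemma bil_tcomp i (g : T -> 'M[R]_n.+1) p v w : dom i p ->
  bil (g p) v w =
  bil (tcomp i g p) (v *m jac (chart_at M p) i p) (w *m jac (chart_at M p) i p).
Proof.
move=> ip; have cp := mem_chart_at M p.
have JJ := jacM cp ip cp; rewrite jac_id// in JJ.
rewrite /bil /tcomp !mulmxA -(mulmxA v (jac _ _ _)) JJ mulmx1 -!mulmxA -trmx_mul.
by rewrite -(mulmxA w (jac _ _ _)) JJ mulmx1.
Qed.

Lemma smooth_bil W (H : T -> 'M[R]_n.+1) (u v : T -> 'rV[R]_n.+1) :
  (forall k l, smooth_fun M W (fun p => H p k l)) ->
  smooth_row W u -> smooth_row W v ->
  smooth_fun M W (fun p => bil (H p) (u p) (v p)).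
Proof.
move=> sH su sv.
apply: (@smooth_fun_ext _ _ _ _ _
  (fun p => \sum_k (\sum_l u p 0 l * H p l k) * v p 0 k)).
  by move=> p _; rewrite /bil mxE; apply: eq_bigr => k _; rewrite !mxE.
apply: smooth_fun_sum => k; apply: smooth_funM => //.
by apply: smooth_fun_sum => l; apply: smooth_funM.
Qed.

Lemma bilDl (B : 'M[R]_n.+1) u v w : bil B (u + v) w = bil B u w + bil B v w.
Proof. by rewrite /bil !mulmxDl mxE. Qed.
Lemma bilZl (B : 'M[R]_n.+1) a v w : bil B (a *: v) w = a * bil B v w.
Proof. by rewrite /bil -!scalemxAl mxE. Qed.
Lemma bil_delta (B : 'M[R]_n.+1) v k : bil B v (delta_mx 0 k) = (v *m B) 0 k.
Proof. by rewrite /bil trmx_delta -colE mxE. Qed.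

End Fields.

(** * Bump functions *)

Section Bump.
Context {R : realType}.

(* The exponent [j] makes the span of the family closed under
   differentiation. *)
Definition flat (j : nat) (s : R) : R :=
  if 0 < s then s^-1 ^+ j * expR (- s^-1) else 0.

(** With y = 1 / s and N = j + 2, the bound (y / N)^N <= exp y gives exp(-1/s) <= (N s)^N, and
    multiplying by s^(-j) leaves N^N s^2. The square is what makes the derivative at 0 vanish. *)
Lemma flat_le j (s : R) : `|flat j s| <= j.+2%:R ^+ j.+2 * s ^+ 2.
Proof.
rewrite /flat; case: ifPn => [s0|_]; last first.
  by rewrite normr0 mulr_ge0// ?sqr_ge0// exprn_ge0.
have si : 0 < s^-1 by rewrite invr_gt0.
rewrite ger0_norm; last by rewrite mulr_ge0 ?exprn_ge0 ?expR_ge0// ltW.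
set N := j.+2.
have H : (s^-1 / N%:R) ^+ N <= expR (s^-1).
  have -> : s^-1 = N%:R * (s^-1 / N%:R) by rewrite mulrCA divff ?mulr1 ?pnatr_eq0.
  rewrite expRM_natl {1}mulrCA divff ?mulr1 ?pnatr_eq0//.
  rewrite lerXn2r// ?nnegrE ?divr_ge0 ?expR_ge0 ?(ltW si)//.
  by apply: le_trans (expR_ge1Dx _); rewrite lerDr.
have H2 : expR (- s^-1) <= (N%:R * s) ^+ N.
  rewrite expRN -[leRHS]invrK lef_pV2 ?posrE ?expR_gt0//.
    by apply: le_trans H; rewrite -exprVn invfM mulrC.
  by rewrite invr_gt0 exprn_gt0// mulr_gt0.
apply: le_trans (ler_wpM2l _ H2) _; first by rewrite exprn_ge0// ltW.
rewrite exprMn mulrCA ler_wpM2l ?exprn_ge0//.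
by rewrite /N -addn2 exprD mulrA -exprMn mulVf ?expr1n ?mul1r// gt_eqF.
Qed.

Lemma flat_gt0 j (s : R) : 0 < s -> flat j s != 0.
Proof.
by move=> s0; rewrite /flat s0 mulf_neq0// gt_eqF ?expR_gt0// exprn_gt0// invr_gt0.
Qed.

Lemma is_derive_flat j (s : R) :
  is_derive s 1 (flat j) (flat j.+2 s - j%:R * flat j.+1 s).
Proof.
have [s0|s0|->] := ltgtP s 0.
- rewrite {2 3}/flat !(lt_gtF s0) mulr0 subr0.
  apply: (@near_eq_is_derive _ _ _ (cst 0)).
  near=> t; rewrite /flat lt_gtF//; near: t; exact: lt_nbhsl.
- rewrite {2 3}/flat s0.
  apply: (@near_eq_is_derive _ _ _ (fun t : R => t^-1 ^+ j * expR (- t^-1))).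
    near=> t; rewrite /flat ifT//; near: t; exact: lt_nbhsr.
  have dV : is_derive s 1 (fun t : R => t^-1) (- s ^- 2).
    have si : s != 0 by rewrite gt_eqF.
    apply: DeriveDef; first exact: (derivableV si (@derivable_id _ _ s 1)).
    rewrite (deriveV si (@derivable_id _ _ s 1)).
    by rewrite derive_id /GRing.scale/= mulr1.
  have dN : is_derive s 1 (fun t : R => - t^-1) (s ^- 2).
    by apply: is_derive_eq; rewrite opprK.
  have dE : is_derive s 1 (fun t : R => expR (- t^-1)) (s ^- 2 * expR (- s^-1)).
    have := is_derive1_comp (is_derive_expR _) dN.
    by move=> H; apply: is_derive_eq; rewrite mulrC.
  case: j => [|j].
    rewrite mul0r subr0 exprVn.
    apply: (@near_eq_is_derive _ _ _ (fun t : R => expR (- t^-1))).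
      by near=> t; rewrite expr0 mul1r.
  have dX : is_derive s 1 (fun t : R => t^-1 ^+ j.+1)
      ((j.+1%:R * s^-1 ^+ j) *: (- s ^- 2 : R^o)).
    by have := is_deriveX j.+1 dV; rewrite exprfctE.
  refine (@is_derive_eq _ _ _ _ _ _ _ _ (is_deriveM dX dE) _).
  rewrite -[LHS]/((s^-1 ^+ j.+1) * (s ^- 2 * expR (- s^-1))
    + expR (- s^-1) * ((j.+1%:R * s^-1 ^+ j) * - s ^- 2)).
  by rewrite -exprVn !exprS; ring.
- have f0 k : flat k 0 = 0 by rewrite /flat ltxx.
  rewrite !f0 mulr0 subr0.
  (* At 0 the quadratic bound makes the difference quotient of order |h|. *)
  have H : (fun h : R => h^-1 *: ((flat j \o shift 0) (h *: 1) - flat j 0))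
      @ 0^' --> (0 : R).
    have K0 : 0 < j.+2%:R ^+ j.+2 :> R by rewrite exprn_gt0.
    apply/cvgr0Pnorm_le => e e0; near=> h.
    rewrite /= addr0 f0 subr0 /GRing.scale/= mulr1 normrM normfV.
    have h0 : h != 0 by near: h; exact: nbhs_dnbhs_neq.
    rewrite mulrC ler_pdivrMr ?normr_gt0//.
    apply: le_trans (flat_le _ _) _.
    rewrite -(real_normK (num_real h)).
    have : `|h| <= e / j.+2%:R ^+ j.+2.
      by near: h; apply: dnbhs0_le; rewrite divr_gt0.
    by rewrite ler_pdivlMr// => he; rewrite expr2 mulrA ler_wpM2r// mulrC.
  by apply: DeriveDef; [apply/cvg_ex; exists 0|exact: cvg_lim].
Unshelve. all: by end_near. Qed.

Context {n : nat}.
Implicit Types (V : set 'rV[R]_n.+1) (q : 'rV[R]_n.+1 -> R).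

Lemma times_differentiable_flat k j V q : open V ->
  times_differentiable k V q -> times_differentiable k V (flat j \o q).
Proof.
move=> oV; elim: k j => [//|k IH] j dq.
have df s : differentiable (flat j) s.
  by apply/derivable1_diffP; have [] := is_derive_flat j s.
split=> [x Vx|v].
  by apply: differentiable_comp => //; apply: dq.1.
have dq' := times_differentiableW dq.
apply: (@times_differentiable_ext _ _ _ _
  ((flat j.+2 \o q + cst (- j%:R) * (flat j.+1 \o q)) * 'D_v q)) => //.
  move=> x Vx; have dqx := dq.1 _ Vx.
  rewrite deriveE; last exact: differentiable_comp.
  rewrite diff_comp//= -[in 'd q x v]deriveE// deriv1E; last first.
    by have [] := is_derive_flat j (q x).
  rewrite derive1E; have [_ ->] := is_derive_flat j (q x).
  rewrite -[LHS]/((flat j.+2 (q x) + - j%:R * flat j.+1 (q x)) * 'D_v q x).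
  by rewrite /GRing.scale/= mulrC mulNr.
apply: times_differentiableM => //; last exact: dq.2.
apply: times_differentiableD => //; first exact: IH.
apply: times_differentiableM => //; first exact: times_differentiable_cst.
exact: IH.
Qed.

End Bump.

(** * Cutoff functions and globally smooth fields *)

Section ManifoldBump.
Context {R : realType} {n : nat} {T : topologicalType} (M : bmanifold R n T).
Implicit Types (i : Defs.index M) (f : T -> R) (U W : set T) (p : T).

Lemma smooth_fun_flat W f j : smooth_fun M W f ->
  smooth_fun M W (fun p => flat j (f p)).
Proof.
move=> sf i x Ax; have [V [F [oV Vx dF Ff]]] := sf i x Ax.
exists V, (flat j \o F); split=> // [k|y Ay Vy]; last by rewrite /= Ff.
exact: times_differentiable_flat.
Qed.

(** [K] is the image of a compact box of the half-space. The Hausdorff property makes it closed in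
    the whole of [T] and not merely in [dom i], so fields multiplied by [chi] extend smoothly by
    zero. *)
Lemma bump i U x0 : open U -> U x0 -> dom i x0 ->
  exists (chi : T -> R) (K : set T),
    [/\ closed K, K `<=` U `&` dom i, smooth_fun M (dom i) chi, chi x0 != 0 &
        forall p, ~ K p -> chi p = 0].
Proof.
move=> oU Ux0 ix0; set a := chart i x0.
have [Q oQ QE] := chart_img i oU.
have [Qa Ha] : (Q `&` half_space) a by rewrite -QE; exists x0.
have /nbhs_ballP[r /= r0 rQ] : nbhs a Q by exact: open_nbhs_nbhs.
(* Half the radius keeps the closed box inside the open ball of radius [r], which is itself a box
   for the sup norm. *)
pose box : set 'rV[R]_n.+1 :=
  [set x | forall k, `[a 0 k - r / 2, a 0 k + r / 2]%classic (x 0 k)].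
pose B := box `&` half_space.
have BQ : B `<=` chart i @` (U `&` dom i).
  move=> x [bx Hx]; rewrite QE; split=> //; apply: rQ; split=> // j k.
  rewrite (ord1 j) /ball/=; have /= := bx k; rewrite in_itv/= => /andP[h1 h2].
  by rewrite ltr_norml; apply/andP; split; lra.
have cB : compact B.
  apply: compact_closedI.
    exact: (rV_compact (fun k => @segment_compact R (a 0 k - r / 2) (a 0 k + r / 2))).
  apply: (@closed_comp _ _ (fun x : 'rV[R]_n.+1 => x 0 ord0) [set t | 0 <= t]).
    by move=> x _; exact: coord_continuous.
  exact: closed_ge.
pose K := chart_inv i @` B.
have KU : K `<=` U `&` dom i.
  by move=> _ [x /BQ /chart_imgW[Ux ix _] <-].
have cK : closed K.
  apply: compact_closed; first exact: (bm_hausdorff M).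
  apply: continuous_compact cB.
  apply: continuous_subspaceW (@chart_inv_continuous _ _ _ M i).
  by move=> x /BQ [p [_ ip] <-]; exists p.
pose q p : R := (r / 2) ^+ 2 - \sum_k (chart i p 0 k - a 0 k) ^+ 2.
(* Outside [dom i] the value of [chart i p] is meaningless, so zero is imposed there. *)
pose chi p : R := if `[< dom i p >] then flat 0 (q p) else 0.
exists chi, K; split=> //.
- apply: (@smooth_fun_ext _ _ _ _ _ (fun p => flat 0 (q p))).
    by move=> p ip; rewrite /chi asboolT.
  apply: smooth_fun_flat; apply: smooth_funB; first exact: smooth_fun_cst.
  apply: smooth_fun_sum => k; apply: smooth_funX; apply: smooth_funB.
    exact: smooth_fun_coord.
  exact: smooth_fun_cst.
- rewrite /chi asboolT//; apply: flat_gt0.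
  rewrite /q big1 ?subr0 ?exprn_gt0 ?divr_gt0// => k _.
  by rewrite subrr expr0n.
- move=> p Kp; rewrite /chi; case: asboolP => // ip.
  (* Chart values always lie in the half-space, so a point of [dom i] outside [K] must violate one
     of the box inequalities. *)
  have Hp : half_space (chart i p).
    have [Q' _ Q'E] := @chart_img_open _ _ _ M i.
    by suff [] : (Q' `&` half_space) (chart i p) by []; rewrite -Q'E; exists p.
  have [k nk] : exists k, ~ `[a 0 k - r / 2, a 0 k + r / 2]%classic (chart i p 0 k).
    apply: contrapT => /forallNP H; apply: Kp; exists (chart i p);
      last by rewrite chartK.
    by split=> // k; apply: contrapT; exact: H.
  rewrite /flat ifF//; apply/negbTE; rewrite -leNgt /q subr_le0.
  rewrite (bigD1 k)//=; apply: (@le_trans _ _ ((chart i p 0 k - a 0 k) ^+ 2)).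
    move: nk; rewrite /= in_itv/= => /negP; rewrite negb_and -!ltNge => /orP[h|h]; nra.
  by rewrite lerDl sumr_ge0// => l _; exact: sqr_ge0.
Qed.

(** Smoothness is local: near a point of [K] the chart is available, and the open complement of [K]
    is where the field vanishes identically. *)
Lemma smooth_bump_field i U (chi : T -> R) (K : set T) (u : T -> 'rV[R]_n.+1) :
  open U -> closed K -> K `<=` U `&` dom i -> smooth_fun M (dom i) chi ->
  (forall p, ~ K p -> chi p = 0) -> smooth_row M (U `&` dom i) u ->
  smooth_vfield M U (fun p => chi p *: of_chart i u p).
Proof.
move=> oU cK KU schi chi0 su j k.
have E p : vcomp j (fun p => chi p *: of_chart i u p) p 0 k =
    chi p * vcomp j (of_chart i u) p 0 k.
  by rewrite /vcomp -scalemxAl mxE.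
apply: smooth_fun_local => p [Up jp].
have oi : open (dom i) by exact: dom_open.
have [Kp|nKp] := pselect (K p).
  exists (U `&` dom i); split; [exact: openI|exact: KU|].
  apply: (@smooth_fun_ext _ _ _ _ _ (fun p => chi p * vcomp j (of_chart i u) p 0 k)).
    by move=> q _; rewrite E.
  apply: smooth_funM; first by apply: smooth_fun_sub schi => q [_ []].
  have sV : smooth_vfield M (U `&` dom i) (of_chart i u).
    by apply: smooth_of_chart => //; exact: openI.
  by apply: smooth_fun_sub (sV j k) => q [[Uq jq] [_ iq]].
exists (~` K); split=> //; first exact: closed_openC.
apply: (@smooth_fun_ext _ _ _ _ _ (fun p => 0)); last exact: smooth_fun_cst.
by move=> q [_ nKq]; rewrite E chi0// mul0r.
Qed.

End ManifoldBump.

(** * The Koszul formula *)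

Section Koszul.
Context {R : realType} {n : nat} {T : topologicalType} (M : bmanifold R n T).
Variables (i : Defs.index M).
Implicit Types (W : set T) (f r A B : T -> R) (p : T).
Implicit Types (X Y Z : T -> 'rV[R]_n.+1) (u v w : T -> 'rV[R]_n.+1).
Implicit Types (G H : T -> 'M[R]_n.+1).

Definition bracket u v p : 'rV[R]_n.+1 :=
  \row_l (vderiv i (u p) (fun q => v q 0 l) p - vderiv i (v p) (fun q => u q 0 l) p).

(** The Koszul expression for 2 G(nabla_u v, w) in the coordinates of [i]. No inverse of [G] enters,
    so it is equally meaningful, and smooth, for h at the boundary. *)
Definition koszul_form G u v w p : R :=
  vderiv i (u p) (fun q => bil (G q) (v q) (w q)) p
  + vderiv i (v p) (fun q => bil (G q) (u q) (w q)) p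
  - vderiv i (w p) (fun q => bil (G q) (u q) (v q)) p
  + bil (G p) (bracket u v p) (w p)
  - bil (G p) (bracket u w p) (v p)
  - bil (G p) (bracket v w p) (u p).

Definition bracket_derives W r u v := forall p, W p ->
  vderiv i (bracket u v p) r p = vderiv i (u p) (fun q => vderiv i (v q) r q) p
                               - vderiv i (v p) (fun q => vderiv i (u q) r q) p.

Lemma smooth_bracket W u v : open W -> W `<=` dom i ->
  smooth_row M W u -> smooth_row M W v -> smooth_row M W (bracket u v).
Proof.
move=> oW Wi su sv k; apply: (@smooth_fun_ext _ _ _ _ _
  (fun p => vderiv i (u p) (fun q => v q 0 k) p - vderiv i (v p) (fun q => u q 0 k) p)).
  by move=> p _; rewrite mxE.
by apply: smooth_funB; apply: smooth_vderiv.
Qed.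

Lemma smooth_koszul_form W H u v w : open W -> W `<=` dom i ->
  (forall k l, smooth_fun M W (fun p => H p k l)) ->
  smooth_row M W u -> smooth_row M W v -> smooth_row M W w ->
  smooth_fun M W (koszul_form H u v w).
Proof.
move=> oW Wi sH su sv sw; rewrite /koszul_form.
have sb := smooth_bracket oW Wi.
repeat first [apply: smooth_funB | apply: smooth_funD];
  first [by apply: smooth_vderiv => //; exact: smooth_bil
        | by apply: smooth_bil => //; exact: sb].
Qed.

(** The summand A H scales the Koszul form of H and adds derivatives of A. In the rank-one summand B
    dr^2 the brackets act as commutators, so the second derivatives of r cancel in pairs except for
    twice u(v r) w(r); what remains are derivatives of B. *)
Lemma koszul_form_decomp W G H A B r u v w p : open W -> W `<=` dom i -> W p ->
  (forall k l, smooth_fun M W (fun p => H p k l)) ->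
  smooth_fun M W A -> smooth_fun M W B -> smooth_fun M W r ->
  smooth_row M W u -> smooth_row M W v -> smooth_row M W w ->
  (forall q, W q -> forall a b, bil (G q) a b =
     A q * bil (H q) a b + B q * (vderiv i a r q * vderiv i b r q)) ->
  bracket_derives W r u v -> bracket_derives W r u w -> bracket_derives W r v w ->
  koszul_form G u v w p =
    A p * koszul_form H u v w p
    + vderiv i (u p) A p * bil (H p) (v p) (w p)
    + vderiv i (v p) A p * bil (H p) (u p) (w p)
    - vderiv i (w p) A p * bil (H p) (u p) (v p)
    + 2 * B p * vderiv i (u p) (fun q => vderiv i (v q) r q) p * vderiv i (w p) r p
    + vderiv i (u p) B p * vderiv i (v p) r p * vderiv i (w p) r p
    + vderiv i (v p) B p * vderiv i (u p) r p * vderiv i (w p) r p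
    - vderiv i (w p) B p * vderiv i (u p) r p * vderiv i (v p) r p.
Proof.
move=> oW Wi Wp sH sA sB sr su sv sw GE buv buw bvw; have ip := Wi _ Wp.
have D (a b c : T -> 'rV[R]_n.+1) : smooth_row M W a -> smooth_row M W b ->
    vderiv i (c p) (fun q => bil (G q) (a q) (b q)) p =
    A p * vderiv i (c p) (fun q => bil (H q) (a q) (b q)) p
    + bil (H p) (a p) (b p) * vderiv i (c p) A p
    + (B p * (vderiv i (a p) r p * vderiv i (c p) (fun q => vderiv i (b q) r q) p
              + vderiv i (b p) r p * vderiv i (c p) (fun q => vderiv i (a q) r q) p)
       + vderiv i (a p) r p * vderiv i (b p) r p * vderiv i (c p) B p).
  move=> sa sb; have sar := smooth_vderiv oW Wi sa sr.
  have sbr := smooth_vderiv oW Wi sb sr; have sab := smooth_funM sar sbr.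
  have sh := smooth_bil sH sa sb.
  rewrite (vderiv_eq (c p) oW Wp ip (fun q Wq => GE q Wq (a q) (b q))).
  rewrite (vderivD (c p) oW Wp ip (smooth_funM sA sh) (smooth_funM sB sab)).
  rewrite (vderivM (c p) oW Wp ip sA sh) (vderivM (c p) oW Wp ip sB sab).
  by rewrite (vderivM (c p) oW Wp ip sar sbr).
by rewrite /koszul_form !D// !(GE p Wp) (buv p Wp) (buw p Wp) (bvw p Wp); ring.
Qed.

Variables (g : T -> 'M[R]_n.+1).
Variable nabla : (T -> 'rV[R]_n.+1) -> (T -> 'rV[R]_n.+1) -> (T -> 'rV[R]_n.+1).
Hypothesis g_metric : pseudo_riemannian M g.
Hypothesis LC : levi_civita M g nabla.

Section OnOpen.
Variable W : set T.
Hypotheses (oW : open W) (Wint : W `<=` interior_part M) (Wi : W `<=` dom i).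

Lemma deriv_along2 X Y f p : smooth_vfield M W X -> smooth_vfield M W Y ->
  smooth_fun M W f -> W p ->
  deriv_along M X (deriv_along M Y f) p =
  vderiv i (vcomp i X p) (fun q => vderiv i (vcomp i Y q) f q) p.
Proof.
move=> sX sY sf Wp; have ip := Wi Wp.
have E q : W q -> deriv_along M Y f q = vderiv i (vcomp i Y q) f q.
  by move=> Wq; apply: deriv_alongE sf => //; exact: Wi.
have sd : smooth_fun M W (fun q => vderiv i (vcomp i Y q) f q).
  by apply: smooth_vderiv => //; exact: smooth_vcomp.
rewrite (@deriv_alongE _ _ _ M i W)//; last first.
  by apply: smooth_fun_ext sd => q Wq; rewrite E.
exact: vderiv_eq oW Wp ip E.
Qed.

Lemma torsion_vcomp X Y p : smooth_vfield M W X -> smooth_vfield M W Y -> W p ->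
  vcomp i (nabla X Y) p - vcomp i (nabla Y X) p =
  bracket (vcomp i X) (vcomp i Y) p.
Proof.
move=> sX sY Wp; have ip := Wi Wp; apply/rowP => l.
have sc : smooth_fun M W (fun q => chart i q 0 l).
  by apply: smooth_fun_sub (@smooth_fun_coord _ _ _ M i l).
have := conn_torsion_free LC.1 oW Wint sX sY sc Wp.
rewrite !deriv_along2// (diff_atE _ oW Wp ip sc) -/(vderiv i _ _ p) vderiv_coord//.
rewrite mulmxBl => ->; rewrite [RHS]mxE.
by congr (_ - _); apply: (vderiv_eq _ oW Wp ip) => q Wq;
  rewrite vderiv_coord//; exact: Wi.
Qed.

(** Obtained from torsion freeness instead of the symmetry of second derivatives: nabla_X Y -
    nabla_Y X acts on every function as the commutator, and testing it on the coordinate functions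
    shows that its components are those of [bracket]. *)
Lemma bracket_derives_vcomp f X Y : smooth_vfield M W X -> smooth_vfield M W Y ->
  smooth_fun M W f -> bracket_derives W f (vcomp i X) (vcomp i Y).
Proof.
move=> sX sY sf p Wp; have ip := Wi Wp.
have := conn_torsion_free LC.1 oW Wint sX sY sf Wp.
rewrite !deriv_along2// => <-.
by rewrite (diff_atE _ oW Wp ip sf) mulmxBl -torsion_vcomp.
Qed.

Lemma koszul X Y Z p : smooth_vfield M W X -> smooth_vfield M W Y ->
  smooth_vfield M W Z -> W p ->
  2 * bil (tcomp i g p) (vcomp i (nabla X Y) p) (vcomp i Z p) =
  koszul_form (tcomp i g) (vcomp i X) (vcomp i Y) (vcomp i Z) p.
Proof.
move=> sX sY sZ Wp; have ip := Wi Wp.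
have sG k l : smooth_fun M W (fun p => tcomp i g p k l).
  apply: smooth_tcomp => // j a b; apply: smooth_fun_sub (g_metric.1 j a b).
  by move=> q [/Wint].
have Gsym a b : bil (tcomp i g p) a b = bil (tcomp i g p) b a.
  have cp := mem_chart_at M p.
  rewrite -(mulmx_jacK a ip cp) -(mulmx_jacK b ip cp) -!bil_tcomp//.
  by rewrite (g_metric.2 p (Wint Wp)).1.
have met (X1 Y1 Z1 : T -> 'rV[R]_n.+1) : smooth_vfield M W X1 -> smooth_vfield M W Y1 ->
    smooth_vfield M W Z1 ->
    vderiv i (vcomp i X1 p)
      (fun q => bil (tcomp i g q) (vcomp i Y1 q) (vcomp i Z1 q)) p =
    bil (tcomp i g p) (vcomp i (nabla X1 Y1) p) (vcomp i Z1 p)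
    + bil (tcomp i g p) (vcomp i Y1 p) (vcomp i (nabla X1 Z1) p).
  move=> s1 s2 s3; have := LC.2 W oW Wint X1 Y1 Z1 s1 s2 s3 p Wp.
  rewrite !(bil_tcomp g _ _ ip) => <-.
  have sg : smooth_fun M W (fun q => bil (tcomp i g q) (vcomp i Y1 q) (vcomp i Z1 q)).
    by apply: smooth_bil => //; exact: smooth_vcomp.
  have E q : W q ->
      bil (tcomp i g q) (vcomp i Y1 q) (vcomp i Z1 q) = bil (g q) (Y1 q) (Z1 q).
    by move=> Wq; rewrite (bil_tcomp g _ _ (Wi Wq)).
  rewrite (@deriv_alongE _ _ _ M i W)//; last exact: smooth_fun_ext sg.
  exact: vderiv_eq oW Wp ip E.
rewrite /koszul_form !met// -!torsion_vcomp//.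
have BN a b c : bil (tcomp i g p) (a - b) c =
    bil (tcomp i g p) a c - bil (tcomp i g p) b c.
  by rewrite -scaleN1r bilDl bilZl mulN1r.
rewrite !BN.
rewrite (Gsym (vcomp i Y p) (vcomp i (nabla X Z) p)).
rewrite (Gsym (vcomp i X p) (vcomp i (nabla Y Z) p)).
rewrite (Gsym (vcomp i X p) (vcomp i (nabla Z Y) p)).
ring.
Qed.

End OnOpen.
End Koszul.

(** * The bordered linear system *)

Section BorderedSystem.
Context {R : realType} {n : nat} {T : topologicalType} (M : bmanifold R n T).
Variables (i : Defs.index M) (g : T -> 'M[R]_n.+1).
Variable nabla : (T -> 'rV[R]_n.+1) -> (T -> 'rV[R]_n.+1) -> T -> 'rV[R]_n.+1.
Hypothesis g_metric : pseudo_riemannian M g.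
Hypothesis LC : levi_civita M g nabla.
Variables (H : T -> 'M[R]_n.+1) (rho C c : T -> R) (d : T -> 'rV[R]_n.+1) (m : nat).
Implicit Types (W : set T) (p : T) (X Y Z : T -> 'rV[R]_n.+1).
Implicit Types (x y z : T -> 'rV[R]_n.+1).

(** The G of the overview, before division by C: it collects the coefficients of drho(Z) / S that
    survive once the correction in N has been taken into account. *)
Definition normal_part x y p : R :=
  c p / 2 * (vderiv i (x p) rho p * vderiv i (y p) rho p)
  + C p * vderiv i (x p) (fun q => vderiv i (y q) rho q) p
  + m.+1%:R / 2 * rho p ^+ m * bil (H p) (x p) (y p).

(** The F of the overview: the part of S / 2 times the Koszul expression that is free of negative
    powers of rho. *)
Definition tangential_part x y z p : R :=
  2^-1 * koszul_form i H x y z p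
  + 2^-1 * (\sum_k x p 0 k * d p 0 k * (vderiv i (y p) rho p * vderiv i (z p) rho p)
  + \sum_k y p 0 k * d p 0 k * (vderiv i (x p) rho p * vderiv i (z p) rho p)
  - \sum_k z p 0 k * d p 0 k * (vderiv i (x p) rho p * vderiv i (y p) rho p)).

(** This is S / 2 times the Koszul formula for g = A h + B drho^2 with A = 1 / S and B = C / S^2.
    Since dA = - ([m.+1] / rho) A drho, the terms in drho(X) h(Y, Z) and drho(Y) h(X, Z) are
    cancelled by the correction in N, while the one in drho(Z) h(X, Y) is the last summand of
    [normal_part]. The cubic term in drho that dA contributes through dB cancels against C / S times
    drho(Z) times drho of the correction. Finally dC feeds [c] into [normal_part] and [d] into
    [tangential_part]. *)
Lemma hat_equation W X Y Z p : open W -> W `<=` interior_part M -> W `<=` dom i ->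
  (forall k l, smooth_fun M W (fun p => H p k l)) ->
  smooth_fun M W rho -> smooth_fun M W C -> (forall q, W q -> rho q != 0) ->
  (forall q, W q -> forall a b, bil (tcomp i g q) a b =
    (rho q ^+ m.+1)^-1 * bil (H q) a b
    + C q * ((rho q ^+ m.+1)^-1 * (rho q ^+ m.+1)^-1)
      * (vderiv i a rho q * vderiv i b rho q)) ->
  W p ->
  (forall k, pderiv i k C p = c p * pderiv i k rho p + rho p ^+ m.+1 * d p 0 k) ->
  smooth_vfield M W X -> smooth_vfield M W Y -> smooth_vfield M W Z ->
  let x := vcomp i X in let y := vcomp i Y in let z := vcomp i Z in
  let N := vcomp i (nabla X Y) p + (m.+1%:R / 2 / rho p) *:
     (vderiv i (x p) rho p *: y p + vderiv i (y p) rho p *: x p) in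
  bil (H p) N (z p) + (rho p ^+ m.+1)^-1 *
     (C p * vderiv i N rho p - normal_part x y p) * vderiv i (z p) rho p =
  tangential_part x y z p.
Proof.
move=> oW Wint Wi sH sr sC r0 GE Wp CE sX sY sZ x y z N.
have ip := Wi _ Wp; have rp := r0 _ Wp.
have sx : smooth_row M W x := smooth_vcomp Wi sX.
have sy : smooth_row M W y := smooth_vcomp Wi sY.
have sz : smooth_row M W z := smooth_vcomp Wi sZ.
pose S q := rho q ^+ m.+1; pose A q := (S q)^-1; pose B q := C q * (A q * A q).
have S0 q : W q -> S q != 0 by move=> Wq; rewrite expf_neq0// r0.
have sS : smooth_fun M W S := smooth_funX m.+1 sr.
have sA : smooth_fun M W A := smooth_funV S0 sS.
have sB : smooth_fun M W B := smooth_funM sC (smooth_funM sA sA).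
have dS (u : 'rV[R]_n.+1) : vderiv i u S p = m.+1%:R * rho p ^+ m * vderiv i u rho p.
  exact: vderivX oW Wp ip sr.
have dA (u : 'rV[R]_n.+1) : vderiv i u A p =
    - (A p * A p) * (m.+1%:R * rho p ^+ m * vderiv i u rho p).
  (* The derivative of 1 / S is found by differentiating the constant S A = 1. *)
  have := vderivM u oW Wp ip sS sA.
  have -> : vderiv i u (fun q => S q * A q) p = 0.
    rewrite -(vderiv_cst i u 1 p); apply: (vderiv_eq _ oW Wp ip) => q Wq.
    by rewrite divff// S0.
  rewrite dS => /esym E; apply: (mulfI (S0 _ Wp)); move/eqP: E.
  by rewrite addr_eq0 => /eqP ->; rewrite {2}/A; field; exact: S0.
have dC (u : 'rV[R]_n.+1) : vderiv i u C p =
    c p * vderiv i u rho p + S p * \sum_k u 0 k * d p 0 k.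
  rewrite /vderiv !big_distrr -big_split; apply: eq_bigr => k _.
  by rewrite CE /S /=; ring.
have dB (u : 'rV[R]_n.+1) : vderiv i u B p =
    C p * (2 * A p * vderiv i u A p) + A p * A p * vderiv i u C p.
  rewrite (vderivM u oW Wp ip sC (smooth_funM sA sA)) (vderivM u oW Wp ip sA sA).
  by ring.
have K := koszul g_metric LC oW Wint Wi sX sY sZ Wp.
rewrite (koszul_form_decomp oW Wi Wp sH sA sB sr sx sy sz GE) in K; last 3 first.
- exact: (bracket_derives_vcomp LC).
- exact: (bracket_derives_vcomp LC).
- exact: (bracket_derives_vcomp LC).
rewrite (GE _ Wp) in K.
rewrite !dB !dC !dA -/x -/y -/z in K.
rewrite /N bilDl bilZl bilDl !bilZl vderivDl vderivZl vderivDl !vderivZl.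
rewrite /normal_part /tangential_part -!big_distrl /=.
move: K; set NN := vcomp i (nabla X Y) p.
set hN := bil (H p) NN (z p); set KH := koszul_form _ _ _ _ _ _.
set xr := vderiv i (x p) rho p; set yr := vderiv i (y p) rho p.
set zr := vderiv i (z p) rho p; set Nr := vderiv i NN rho p.
set Dx := \sum_k x p 0 k * _; set Dy := \sum_k y p 0 k * _.
set Dz := \sum_k z p 0 k * _.
set hxy := bil _ _ (y p); set hyz := bil _ (y p) _; set hxz := bil _ (x p) (z p).
set xyr := vderiv i (x p) _ p.
rewrite -/(S p) -/(A p) /B => K.
have SE : S p = rho p * rho p ^+ m by rewrite /S exprS.
(* The left side of the Koszul formula solved for h(nabla_X Y, Z), so that substituting [K]
   eliminates this unknown. *)
have hE : hN = S p * (2^-1 * (2 * (A p * hN + C p * (A p * A p) * (Nr * zr)))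
    - C p * (A p * A p) * (Nr * zr)).
  by rewrite /A; field; exact: S0.
rewrite K in hE; rewrite hE /A SE.
(* After S = rho * rho^m, the power rho^m is generalized to a nonzero scalar, and a rational
   identity is left. *)
have rm0 : rho p ^+ m != 0 by rewrite expf_neq0.
move: (rho p ^+ m) rm0 => s s0.
by field; rewrite rp s0.
Qed.

End BorderedSystem.

(** * Smooth dependence of determinants and inverse matrices *)

Section SmoothMatrix.
Context {R : realType} {n : nat} {T : topologicalType} (M : bmanifold R n T).
Implicit Types (W : set T).

Lemma smooth_det W N (B : T -> 'M[R]_N) :
  (forall a b, smooth_fun M W (fun p => B p a b)) ->
  smooth_fun M W (fun p => \det (B p)).
Proof.
move=> sB; rewrite /determinant; apply: smooth_fun_sum => s.
apply: smooth_funM; first exact: smooth_fun_cst.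
by apply: smooth_fun_prod => k; exact: sB.
Qed.

(** Cramer's rule: an entry of the inverse is a signed minor, hence the determinant of a smooth
    matrix, divided by the full determinant. *)
Lemma smooth_invmx W N (B : T -> 'M[R]_N) a b :
  (forall p, W p -> \det (B p) != 0) ->
  (forall a b, smooth_fun M W (fun p => B p a b)) ->
  smooth_fun M W (fun p => invmx (B p) a b).
Proof.
move=> B0 sB; apply: (@smooth_fun_ext _ _ _ _ _
  (fun p => (\det (B p))^-1 * ((-1) ^+ (b + a) * \det (row' b (col' a (B p)))))).
  move=> p Wp; rewrite /invmx unitmxE unitfE B0// !mxE /cofactor.
  by congr (_ * (_ * \det _)); apply/matrixP => k l; rewrite !mxE.
apply: smooth_funM; first by apply: smooth_funV => //; exact: smooth_det.
apply: smooth_funM; first exact: smooth_fun_cst.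
apply: smooth_det => k l.
by apply: (smooth_fun_ext _ (sB (lift b k) (lift a l))) => p _; rewrite !mxE.
Qed.

Lemma open_smooth_neq0 W f : open W -> smooth_fun M W f ->
  open (W `&` [set p | f p != 0]).
Proof.
move=> oW sf; rewrite openE => p [Wp fp]; apply: filterI.
  exact: open_nbhs_nbhs.
have n0 : nbhs (f p) [set y | y != 0].
  by apply: open_nbhs_nbhs; split=> //; exact: open_neq.
exact: (smooth_fun_continuous oW Wp sf n0).
Qed.

End SmoothMatrix.

(** * Defining functions in coordinates at a boundary point *)

Section Boundary.
Context {R : realType} {n : nat} {T : topologicalType} (M : bmanifold R n T).

Lemma derive_ge0_at_min (F : 'rV[R]_n.+1 -> R) (V : set 'rV[R]_n.+1) x v :
  open V -> V x -> (forall y, V y -> F x <= F y) -> differentiable F x ->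
  0 <= 'D_v F x.
Proof.
move=> oV Vx Fx dF; have c := cvg_right_derive (v := v) dF.
rewrite -(cvg_lim _ c)//; apply: limr_ge; first by apply/cvg_ex; exists ('D_v F x).
near=> t; have t0 : 0 <= t by near: t; exact: nbhs_right_ge.
have Vt : V (x + t *: v) by near: t; exact: near_line.
by rewrite mulr_ge0 ?invr_ge0// subr_ge0 Fx.
Unshelve. all: by end_near. Qed.

(** [boundary] only provides some chart sending [x0] to the wall of the half-space. If the chart [i]
    did not, rho >= 0 = rho(x0) would have an interior minimum there and drho would vanish. Once
    [x0] is on the wall in the chart [i], moving in a direction k other than 0 stays in the zero set
    of rho, so only the derivative in direction 0 can be nonzero. *)
Lemma defining_function_chart (U : set T) (rho : T -> R) x0 :
  let i := chart_at M x0 in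
  open U -> U x0 -> defining_function M U rho -> boundary M x0 ->
  (forall k, k != ord0 -> pderiv i k rho x0 = 0) /\ pderiv i ord0 rho x0 != 0.
Proof.
move=> i oU Ux0 [sr rge0 r0 dr] bx0.
have ix0 : dom i x0 := mem_chart_at M x0.
have [v dv] := dr _ Ux0 bx0.
have rx0 : rho x0 = 0 by apply/r0.
have A0 : (chart i @` (U `&` dom i)) (chart i x0) by exists x0.
have oA := chart_img i oU; have [Q oQ QE] := oA.
have [Qx Hx] : (Q `&` half_space) (chart i x0) by rewrite -QE.
have c0 : chart i x0 0 ord0 = 0.
  apply/eqP; apply: contraNT dv => cn0.
  have cgt0 : 0 < chart i x0 0 ord0 by rewrite lt_neqAle eq_sym cn0.
  suff z k : pderiv i k rho x0 = 0.
    by rewrite /diff_at big1// => k _; rewrite -/(pderiv i k rho x0) z mulr0.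
  have [V [F [oV Vx dF Ff]]] := sr i _ A0.
  rewrite /pderiv (partialE k oA A0 oV Vx dF Ff).
  have dFx := C_infty_differentiable dF Vx.
  pose P := (V `&` Q) `&` [set y | 0 < y 0 ord0].
  have oP : open P.
    apply: openI; first exact: openI.
    apply: (@open_comp _ _ (fun y : 'rV[R]_n.+1 => y 0 ord0) [set t | 0 < t]).
      by move=> y _; exact: coord_continuous.
    exact: open_gt.
  have Px : P (chart i x0) by [].
  have Fmin y : P y -> F (chart i x0) <= F y.
    move=> [[Vy Qy] /= y0].
    have Ay : (chart i @` (U `&` dom i)) y by rewrite QE; split=> //; exact: ltW.
    rewrite !Ff//= chartK// rx0; apply: rge0.
    by have [] := chart_imgW Ay.
  apply/eqP; rewrite eq_le (derive_ge0_at_min _ oP Px)// andbT.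
  (* At the minimum the derivatives along e_k and along - e_k are both nonnegative. *)
  have := derive_ge0_at_min (- delta_mx 0 k) oP Px Fmin dFx.
  by rewrite !deriveE// linearN oppr_ge0.
have z k : k != ord0 -> pderiv i k rho x0 = 0.
  move=> k0; apply: cvg_lim => //; apply: cvg_near_cst; near=> t.
  have Qt : Q (chart i x0 + t *: delta_mx 0 k) by near: t; exact: near_line.
  have t0 : 0 <= t by near: t; exact: nbhs_right_ge.
  have : (chart i @` (U `&` dom i)) (chart i x0 + t *: delta_mx 0 k).
    by rewrite QE; split=> //; exact: half_space_scale.
  move=> /chart_imgW[Ut it tE].
  have -> : (rho \o chart_inv i) (chart i x0 + t *: delta_mx 0 k) = 0.
    apply/r0 => //; exists i; split=> //; rewrite tE !mxE c0 eqxx eq_sym (negPf k0).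
    by rewrite mulr0 addr0.
  by rewrite /= chartK// rx0 subr0 mulr0.
split=> //; apply: contraNneq dv => z0; rewrite /diff_at big1// => k _.
rewrite -/(pderiv i k rho x0); have [->|k0] := eqVneq k ord0; first by rewrite z0 mulr0.
by rewrite z// mulr0.
Unshelve. all: by end_near. Qed.

End Boundary.

(** * Invertibility of the bordered matrix at the boundary *)

Section Bordered.
Context {R : realType} {n : nat}.

(** For a kernel vector (a, b) the last column says r(a) = 0, so a is tangent to the boundary. The
    other columns say B(a, .) = - b r, which vanishes on tangent vectors; nondegeneracy there gives
    a = 0, and then b r = 0 gives b = 0. *)
Lemma det_bordered (B : 'M[R]_n.+1) (r : 'rV[R]_n.+1) :
  (forall k, k != ord0 -> r 0 k = 0) -> r 0 ord0 != 0 ->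
  nondegenerate_on tangent_boundary B ->
  \det (block_mx B r^T r (0 : 'M[R]_1)) != 0.
Proof.
move=> rk r0 nd; apply/negP => /det0P[v v0]; rewrite -[v]hsubmxK.
set a := lsubmx v; set b := rsubmx v.
rewrite mul_row_block mulmx0 addr0 => /eqP.
rewrite -row_mx0 => /eqP/eq_row_mx[E1 E2].
have rE (w : 'rV[R]_n.+1) : (w *m r^T) 0 0 = w 0 ord0 * r 0 ord0.
  rewrite mxE (bigD1 ord0)//= big1 ?addr0 ?mxE// => k k0.
  by rewrite mxE rk// mulr0.
have a0 : tangent_boundary a.
  have := rE a; rewrite E2 mxE => /esym/eqP; rewrite mulf_eq0 (negPf r0) orbF.
  by move/eqP.
have az : a = 0.
  apply: nd => // w w0; rewrite /bil.
  move/eqP: E1; rewrite addr_eq0 => /eqP ->.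
  rewrite mulNmx -mulmxA mxE.
  have -> : r *m w^T = 0.
    apply/matrixP => k l; rewrite !ord1 -[r *m w^T]trmxK trmx_mul trmxK mxE rE w0.
    by rewrite mul0r mxE.
  by rewrite mulmx0 mxE oppr0.
have bz : b = 0.
  apply/matrixP => k l; rewrite !ord1 [in RHS]mxE.
  move: E1; rewrite az mul0mx add0r => /matrixP/(_ 0 ord0).
  rewrite [RHS]mxE mxE big_ord1 => /eqP; rewrite mulf_eq0 (negPf r0) orbF.
  by move/eqP.
by move: v0; rewrite -[v]hsubmxK -/a -/b az bz row_mx0 eqxx.
Qed.

End Bordered.

(** * Smoothness of the right-hand side of the system *)

Section Smoothness.
Context {R : realType} {n : nat} {T : topologicalType} (M : bmanifold R n T).
Variables (i : Defs.index M) (W : set T).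
Hypotheses (oW : open W) (Wi : W `<=` dom i).
Variables (H : T -> 'M[R]_n.+1) (rho C c : T -> R) (d : T -> 'rV[R]_n.+1) (m : nat).
Hypotheses (sH : forall k l, smooth_fun M W (fun p => H p k l))
  (sr : smooth_fun M W rho) (sC : smooth_fun M W C) (sc : smooth_fun M W c)
  (sd : smooth_row M W d).
Variables (x y z : T -> 'rV[R]_n.+1).
Hypotheses (sx : smooth_row M W x) (sy : smooth_row M W y) (sz : smooth_row M W z).

Lemma smooth_normal_part : smooth_fun M W (normal_part i H rho C c m x y).
Proof.
have sv := smooth_vderiv oW Wi; have k0 := @smooth_fun_cst _ _ _ M W.
apply: smooth_funD; first apply: smooth_funD.
- apply: smooth_funM; first exact: smooth_funM.
  by apply: smooth_funM; exact: sv.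
- by apply: smooth_funM => //; apply: (sv) => //; exact: sv.
- apply: smooth_funM; last exact: smooth_bil.
  by apply: smooth_funM => //; exact: smooth_funX.
Qed.

Lemma smooth_tangential_part : smooth_fun M W (tangential_part i H rho d x y z).
Proof.
have sv := smooth_vderiv oW Wi; have k0 := @smooth_fun_cst _ _ _ M W.
have D a b e : smooth_row M W a -> smooth_row M W b -> smooth_row M W e ->
    smooth_fun M W (fun p => \sum_k a p 0 k * d p 0 k *
      (vderiv i (b p) rho p * vderiv i (e p) rho p)).
  move=> sa sb se; apply: smooth_fun_sum => k.
  apply: smooth_funM; first exact: smooth_funM.
  by apply: smooth_funM; exact: sv.
apply: smooth_funD; first by apply: smooth_funM => //; exact: smooth_koszul_form.
apply: smooth_funM => //; apply: smooth_funB; last exact: D.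
by apply: smooth_funD; exact: D.
Qed.

End Smoothness.

(** * Derivatives of C along the kernel of drho *)

Section TangentialDerivative.
Context {R : realType} {n : nat} {T : topologicalType} (M : bmanifold R n T).

(* The hypothesis on [C] can only be applied to fields that are smooth on all
   of [U], not just in the chart, hence the cutoff [chi]. *)
Lemma tangential_derivative (i : Defs.index M) (U : set T) (x0 : T) (rho C S : T -> R) :
  open U -> U x0 -> dom i x0 -> smooth_fun M U rho -> smooth_fun M U C ->
  (forall zeta, smooth_vfield M U zeta ->
     (forall p, U p -> diff_at M rho p (zeta p) = 0) ->
     exists2 f : T -> R, smooth_fun M U f &
       forall p, U p -> interior_part M p -> f p = S p * deriv_along M zeta C p) ->
  exists (chi : T -> R) (f : 'I_n.+1 -> T -> R),
    [/\ smooth_fun M (dom i) chi, chi x0 != 0, forall k, smooth_fun M U (f k) &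
        forall k p, U p -> dom i p -> interior_part M p ->
          f k p = S p * (chi p * (pderiv i ord0 rho p * pderiv i k C p
                                  - pderiv i k rho p * pderiv i ord0 C p))].
Proof.
move=> oU Ux0 ix0 sr sC tC.
have [chi [K [cK KU schi chi0 chiK]]] := bump oU Ux0 ix0.
have oU1 : open (U `&` dom i) by apply: openI => //; exact: dom_open.
(* These vectors are annihilated by drho, and they span its kernel wherever the derivative of rho in
   direction 0 is nonzero. *)
pose u k p : 'rV[R]_n.+1 :=
  pderiv i ord0 rho p *: delta_mx 0 k - pderiv i k rho p *: delta_mx 0 ord0.
have sp k : smooth_fun M (U `&` dom i) (pderiv i k rho).
  by apply: smooth_pderiv => //; apply: smooth_fun_sub sr => p [].
have su k : smooth_row M (U `&` dom i) (u k).
  move=> l; apply: (@smooth_fun_ext _ _ _ _ _ (fun p =>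
    pderiv i ord0 rho p * (delta_mx 0 k : 'rV[R]_n.+1) 0 l
    - pderiv i k rho p * (delta_mx 0 ord0 : 'rV[R]_n.+1) 0 l)).
    by move=> p _; rewrite !mxE.
  by apply: smooth_funB; apply: smooth_funM => //; exact: smooth_fun_cst.
have uE k f p : vderiv i (u k p) f p =
    pderiv i ord0 rho p * pderiv i k f p - pderiv i k rho p * pderiv i ord0 f p.
  by rewrite /u -scaleNr vderivDl !vderivZl !vderiv_delta mulNr.
pose zeta k p := chi p *: of_chart i (u k) p.
have zE k f p : U p -> smooth_fun M U f -> dom i p ->
    diff_at M f p (zeta k p) = chi p * vderiv i (u k p) f p.
  move=> Up sf ip; rewrite (diff_atE _ oU Up ip sf) -/(vderiv i _ f p).
  by rewrite -scalemxAl vderivZl -/(vcomp i _ p) vcomp_of_chart.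
have /choice[f Hf] : forall k, exists f : T -> R, smooth_fun M U f /\
    forall p, U p -> dom i p -> interior_part M p ->
      f p = S p * (chi p * (pderiv i ord0 rho p * pderiv i k C p
                            - pderiv i k rho p * pderiv i ord0 C p)).
  move=> k; have [|p Up|f sf fE] := tC (zeta k).
  - exact: (smooth_bump_field oU cK KU schi chiK (su k)).
  - have [ip|nip] := pselect (dom i p); last first.
      rewrite /zeta chiK ?scale0r; last by move=> /KU[].
      by rewrite /diff_at big1// => l _; rewrite mxE mul0r.
    by rewrite zE// uE [pderiv i ord0 rho p * _]mulrC subrr mulr0.
  - exists f; split=> // p Up ip intp; by rewrite fE// /deriv_along zE// uE.
exists chi, f; split=> // k; first by have [] := Hf k.
by have [_] := Hf k.
Qed.

End TangentialDerivative.

(** * Smooth extension of the modified connection near a boundary point *)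

Theorem theorem2p6 (R : realType) (n : nat) (T : topologicalType)
    (M : bmanifold R n T) (alpha : R)
    (alpha_gt0 : 0 < alpha) (alpha_le2 : alpha <= 2)
    (alpha_int : 2 / alpha \is a Num.int)
    (g : T -> 'M[R]_n.+1) (g_metric : pseudo_riemannian M g)
    (g_asymptotic : forall x0 : T, boundary M x0 ->
      exists (U : set T) (rho C : T -> R),
        [/\ open U, U x0, defining_function M U rho,
            smooth_fun M U C /\ (forall p, U p -> C p != 0) &
          (forall zeta : T -> 'rV[R]_n.+1, smooth_vfield M U zeta ->
             (forall p, U p -> diff_at M rho p (zeta p) = 0) ->
             exists2 f : T -> R, smooth_fun M U f &
               forall p, U p -> interior_part M p ->
                 f p = rho p `^ (- (2 / alpha)) * deriv_along M zeta C p) /\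
          (exists h : T -> 'M[R]_n.+1,
             [/\ smooth_tensor2 M U h,
                 forall p, U p -> interior_part M p -> forall v w,
                   bil (h p) v w =
                     rho p `^ (2 / alpha) * bil (g p) v w
                     - C p * (diff_at M rho p v * diff_at M rho p w)
                         / rho p `^ (2 / alpha) &
                 forall p, U p -> boundary M p ->
                   nondegenerate_on tangent_boundary (h p)])]) :
  projectively_compact M alpha g.
Proof.
move=> nabla LC x0 bx0.
have [U [rho [C [oU Ux0 dr [sC C0] [tangC [h [sh hE hnd]]]]]]] := g_asymptotic x0 bx0.
have [sr rge0 r0 _] := dr.
have [m mE] : exists m, 2 / alpha = m.+1%:R.
  have a0 : 0 < 2 / alpha by rewrite divr_gt0.
  have : 2 / alpha \is a Num.nat by rewrite natrEint alpha_int ltW.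
  move=> /natrP[[|m] mE]; last by exists m.
  by rewrite mE ltxx in a0.
pose i := chart_at M x0; have ix0 : dom i x0 := mem_chart_at M x0.
have powS p : U p -> rho p `^ (2 / alpha) = rho p ^+ m.+1.
  by move=> Up; rewrite mE powR_mulrn// rge0.
have powSN p : U p -> rho p `^ (- (2 / alpha)) = (rho p ^+ m.+1)^-1.
  by move=> Up; rewrite powRN powS.
have [chi [f [schi chi0 sf fE]]] := tangential_derivative oU Ux0 ix0 sr sC tangC.
pose U1 := U `&` dom i.
have oU1 : open U1 by apply: openI => //; exact: dom_open.
have U1i : U1 `<=` dom i by move=> p [].
have U1U : U1 `<=` U by move=> p [].
have sr1 : smooth_fun M U1 rho by exact: smooth_fun_sub sr.
have sC1 : smooth_fun M U1 C by exact: smooth_fun_sub sC.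
have C01 p : U1 p -> C p != 0 by move=> [/C0].
have srk k : smooth_fun M U1 (pderiv i k rho) by exact: smooth_pderiv.
pose H := tcomp i h; pose dr1 p : 'rV[R]_n.+1 := \row_k pderiv i k rho p.
have sH k l : smooth_fun M U1 (fun p => H p k l).
  apply: smooth_tcomp => // j a b; apply: smooth_fun_sub (sh j a b).
  by move=> p [[]].
pose P p : 'M[R]_(n.+1 + 1) :=
  block_mx (H p) (dr1 p)^T (dr1 p) (- (rho p ^+ m.+1 / C p))%:M.
have sP a b : smooth_fun M U1 (fun p => P p a b).
  case: (split_ordP a) => a' ->; case: (split_ordP b) => b' ->.
  - by apply: (smooth_fun_ext _ (sH a' b')) => p _; rewrite block_mxEul.
  - by apply: (smooth_fun_ext _ (srk a')) => p _; rewrite block_mxEur !mxE.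
  - by apply: (smooth_fun_ext _ (srk b')) => p _; rewrite block_mxEdl !mxE.
  - apply: (@smooth_fun_ext _ _ _ _ _ (fun p => - (rho p ^+ m.+1 * (C p)^-1))).
      by move=> p _; rewrite block_mxEdr !ord1 mxE eqxx mulr1n.
    by apply: smooth_funN; apply: smooth_funM; [exact: smooth_funX|exact: smooth_funV].
have [rk rz] := defining_function_chart oU Ux0 dr bx0.
have rx0 : rho x0 = 0 by apply/r0.
(* The exponent [m.+1] is positive, so the corner entry vanishes at [x0] and the bordered
   determinant has corner 0. *)
have P0 : \det (P x0) != 0.
  rewrite /P rx0 expr0n mul0r oppr0 raddf0; apply: det_bordered.
  - by move=> k k0; rewrite mxE rk.
  - by rewrite mxE.
  - by rewrite /H /tcomp jac_id// trmx1 mulmx1 mul1mx; exact: hnd.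
(* A single function whose nonvanishing allows every division below: by the determinant in Cramer's
   rule, and by [chi] and the derivative of rho in direction 0 in [c] and [d]. *)
pose det3 p := \det (P p) * (chi p * pderiv i ord0 rho p).
have schi1 : smooth_fun M U1 chi by exact: smooth_fun_sub schi.
have sdet3 : smooth_fun M U1 det3.
  by apply: smooth_funM; [exact: smooth_det|exact: smooth_funM].
pose U2 := U1 `&` [set p | det3 p != 0].
have oU2 : open U2 := open_smooth_neq0 oU1 sdet3.
have U2P p : U2 p -> [/\ \det (P p) != 0, chi p != 0 & pderiv i ord0 rho p != 0].
  by case=> _ /=; rewrite /det3 !mulf_eq0 !negb_or => /and3P.
exists U2, rho; split=> //.
- by split=> //=; rewrite /det3 !mulf_neq0.
- split.
  + by apply: smooth_fun_sub sr => p [[]].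
  + by move=> p [[Up _] _]; exact: rge0.
  + by move=> p [[Up _] _]; exact: r0.
  + by move=> p [[Up _] _]; have [_ _ _] := dr; apply.
move=> W oW WU2 X Y sX sY.
have WU1 : W `<=` U1 by move=> p /WU2[].
have Wi : W `<=` dom i by move=> p /WU1[].
(* These solve dC = c drho + S d: since f_k is chi / S times (d_0 rho) (d_k C) - (d_k rho) (d_0 C),
   dividing by chi d_0 rho isolates d_k C. *)
pose c p := pderiv i ord0 C p / pderiv i ord0 rho p.
pose d p : 'rV[R]_n.+1 := \row_k (f k p / (chi p * pderiv i ord0 rho p)).
(* Coordinate fields of the chart; as Z runs through them, the identity for all Z becomes a finite
   linear system. *)
pose e k := of_chart i (fun=> delta_mx 0 k : 'rV[R]_n.+1).
have se W' k : open W' -> W' `<=` dom i -> smooth_vfield M W' (e k).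
  by move=> oW' W'i; apply: smooth_of_chart => // l; exact: smooth_fun_cst.
pose G p := normal_part i H rho C c m (vcomp i X) (vcomp i Y) p / C p.
pose F k p := tangential_part i H rho d (vcomp i X) (vcomp i Y) (vcomp i (e k)) p.
pose rhs p : 'rV[R]_(n.+1 + 1) := row_mx (\row_k F k p) (G p)%:M.
pose sol p := rhs p *m invmx (P p).
have res (q : T -> R) : smooth_fun M U1 q -> smooth_fun M W q.
  exact: smooth_fun_sub.
have sc : smooth_fun M W c.
  apply: smooth_funM; first by apply: res; exact: smooth_pderiv.
  by apply: smooth_funV; [move=> p /WU2/U2P[]|exact: res].
have sd : smooth_row M W d.
  move=> k; apply: (@smooth_fun_ext _ _ _ _ _
      (fun p => f k p * (chi p * pderiv i ord0 rho p)^-1)).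
    by move=> p _; rewrite mxE.
  apply: smooth_funM; first by apply: smooth_fun_sub (sf k) => p /WU1[].
  apply: smooth_funV; first by move=> p /WU2/U2P[_ ? ?]; rewrite mulf_neq0.
  by apply: res; exact: smooth_funM.
have sHW k l : smooth_fun M W (fun p => H p k l) by exact: res.
have srW := res _ sr1; have sCW := res _ sC1.
have sx : smooth_row M W (vcomp i X) := smooth_vcomp Wi sX.
have sy : smooth_row M W (vcomp i Y) := smooth_vcomp Wi sY.
have sF k : smooth_fun M W (F k).
  apply: smooth_tangential_part => //.
  by apply: smooth_vcomp => //; exact: se.
have sG : smooth_fun M W G.
  apply: smooth_funM; first exact: smooth_normal_part.
  by apply: smooth_funV => // p /WU1/C01.
have srhs a : smooth_fun M W (fun p => rhs p 0 a).
  case: (split_ordP a) => a' ->.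
    by apply: (smooth_fun_ext _ (sF a')) => p _; rewrite row_mxEl mxE.
  by apply: (smooth_fun_ext _ sG) => p _; rewrite row_mxEr !ord1 mxE eqxx mulr1n.
(* The extension is the Cramer solution on all of [W], boundary points included, with the auxiliary
   unknown t discarded. *)
exists (of_chart i (fun p => lsubmx (sol p))).
  apply: smooth_of_chart => // k.
  apply: (@smooth_fun_ext _ _ _ _ _
    (fun p => \sum_a rhs p 0 a * invmx (P p) a (lshift 1 k))).
    by move=> p _; rewrite !mxE.
  apply: smooth_fun_sum => a; apply: smooth_funM => //.
  apply: smooth_invmx; first by move=> p /WU2/U2P[].
  by move=> a' b'; apply: res.
move=> p Wp intp; have ip := Wi _ Wp; have [Up _] := WU1 _ Wp.
pose W' := W `&` [set q | rho q != 0].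
have oW' : open W' := open_smooth_neq0 oW srW.
have W'W : W' `<=` W by move=> q [].
have W'int : W' `<=` interior_part M.
  move=> q [Wq /= rq] bq; move/eqP: rq; apply.
  by apply/r0 => //; have [] := WU1 _ Wq.
have rp : rho p != 0.
  by apply/eqP => /(r0 _ Up) bp; exact: intp.
have W'p : W' p by [].
have W'i : W' `<=` dom i by move=> q /W'W/Wi.
have GE q : W' q -> forall a b, bil (tcomp i g q) a b =
    (rho q ^+ m.+1)^-1 * bil (H q) a b
    + C q * ((rho q ^+ m.+1)^-1 * (rho q ^+ m.+1)^-1)
      * (vderiv i a rho q * vderiv i b rho q).
  move=> W'q a b; have iq := W'i _ W'q; have [Uq _] := WU1 _ (W'W _ W'q).
  have cq := mem_chart_at M q.
  rewrite -(mulmx_jacK a iq cq) -(mulmx_jacK b iq cq) -!bil_tcomp// hE//;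
    last exact: W'int.
  rewrite powS// !(diff_atE _ oU Uq iq sr) -!/(vderiv i _ rho q).
  have [_ /= rq] := W'q; by field; rewrite expf_neq0.
have CE k : pderiv i k C p = c p * pderiv i k rho p + rho p ^+ m.+1 * d p 0 k.
  have [_ chip rp0] := U2P _ (WU2 _ Wp).
  by rewrite mxE fE// powSN// /c; field;
    rewrite rp0 chip expf_neq0.
have sub (Z : T -> 'rV[R]_n.+1) : smooth_vfield M W Z -> smooth_vfield M W' Z.
  by move=> sZ j k; apply: smooth_fun_sub (sZ j k) => q [/W'W].
have HE k := hat_equation g_metric LC oW' W'int W'i
  (fun k l => smooth_fun_sub W'W (sHW k l)) (smooth_fun_sub W'W srW)
  (smooth_fun_sub W'W sCW) (fun q (W'q : W' q) => W'q.2) GE W'p CE (sub _ sX) (sub _ sY)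
  (se W' k oW' W'i).
move: HE => /=; set N := _ + _ => HE.
set t := _ * (_ - _) in HE.
have sysN : row_mx N t%:M *m P p = rhs p.
  rewrite mul_row_block /rhs; congr row_mx.
    apply/rowP => k; rewrite [RHS]mxE /F -HE vcomp_of_chart// bil_delta vderiv_delta.
    by rewrite mul_scalar_mx !mxE.
  (* The last column is the definition of [t] solved for drho(N). *)
  apply/matrixP => a b; rewrite !ord1 mul_scalar_mx !mxE !eqxx !mulr1n.
  have -> : \sum_j N 0 j * (dr1 p)^T j 0 = vderiv i N rho p.
    by apply: eq_bigr => k _; rewrite !mxE.
  rewrite /t /G; field; rewrite C01 ?expf_neq0//; exact: WU1.
have Pu : P p \in unitmx by rewrite unitmxE unitfE; have [] := U2P _ (WU2 _ Wp).
have solE : lsubmx (sol p) = N by rewrite /sol -sysN mulmxK// row_mxKl.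
rewrite -[RHS](of_chart_vcomp (M := M) (i := i))// /of_chart solE; congr (_ *m _).
rewrite /vcomp /proj_change !mulmxDl -!scalemxAl -addrA; congr (_ + _).
rewrite scalerDr !scalerA !(diff_atE _ oU Up ip sr) -!/(vderiv i _ rho p).
(* Half of [m.+1] = 2 / alpha is 1 / alpha, so the correction in N is exactly the prescribed
   projective change. *)
have aE : m.+1%:R / 2 / rho p = (alpha * rho p)^-1.
  by rewrite -mE; field; rewrite rp gt_eqF.
by rewrite aE !(mulrC (_^-1)).
Qed.
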